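(* Let $a,c$ be nonzero complex numbers and let $\ell,m,n$ be nonnegative integers. Then $$ {}_4\phi_3\left[\begin{matrix}q^{-n},\,a,\,c,\,-q^{1+\ell+m-n}/(ac)\\ q^{1+\ell-n}/a,\,q^{1+m-n}/c,\,-ac\end{matrix};q,q\right] =\frac{(q^{1+\ell-n}/a^2,\,-q/a;q)_\ell}{(q^{1+\ell}/a^2,\,-q^{1-n}/a;q)_\ell}\, \frac{(-a,\,q^{-m}c^2;q)_n}{(-ac,\,q^{-m}c;q)_n}\sum_{i=0}^{\ell}\sum_{j=0}^{m}T_{i,j}, $$ where $$ T_{i,j}=(-1)^{i+j}q^{ni+(n-i-j)(j-m)+\binom{j+1}{2}}\,a^ic^{n-i}\,\frac{1-q^{2i-2\ell-1}a^2}{1-q^{-2\ell-1}a^2}\, \frac{(q^{-\ell},q^{-n},q^{-2\ell-1}a^2;q)_i}{(q,\,q^{n-2\ell}a^2,\,q^{-\ell}a^2;q)_i} $$ $$ \times\frac{(q^{-m},\,q^{i-n},\,q^{1+2\ell-n-i}/a^2,\,q^{-m}c,\,-q^{-m}c;q)_j}{(q,\,q^{1+\ell-n}/a,\,-q^{1+\ell-n}/a,\,q^{-m}c^2,\,q^{j-2m-1}c^2;q)_j}\, \frac{(q,\,q^{2+2\ell+2m-2n}/(a^2c^2);q^2)_{(n-i-j)/2}}{(q^{2+2\ell-2n+2j}/a^2,\,q^{1-2m+2j}c^2;q^2)_{(n-i-j)/2}}\,\chi(n-i-j). $$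
   Context: $q$ is a nonzero complex number. For complex $x$ and an integer $n\ge 0$, the $q$-shifted factorial is $(x;q)_0=1$, $(x;q)_n=\prod_{k=0}^{n-1}(1-xq^k)$, and $(x_1,\dots,x_r;q)_n=\prod_{s=1}^r (x_s;q)_n$ (likewise with base $q^2$ in place of $q$). The basic hypergeometric series is ${}_4\phi_3\left[\begin{matrix}a_0,a_1,a_2,a_3\\ b_1,b_2,b_3\end{matrix};q,z\right]=\sum_{k\ge0}\frac{(a_0,a_1,a_2,a_3;q)_k}{(q,b_1,b_2,b_3;q)_k}z^k$. Here one upper parameter is $q^{-n}$, so the series terminates and means the sum over $0\le k\le n$. Parameters are assumed to be such that no zero factor appears in a denominator of the displayed expressions. Put $\chi(k)=\{1+(-1)^k\}/2$. A term with $i+j>n$ contains the vanishing factor $(q^{-n};q)_i(q^{i-n};q)_j$ and is read as $0$; terms with $\chi(n-i-j)=0$ are also read as $0$. *)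

(* Defs.v *)
From HB Require Import structures.
From mathcomp Require Import all_boot all_order all_algebra.
From mathcomp Require Import reals.
From mathcomp Require Export complex.

Set Implicit Arguments.
Unset Strict Implicit.
Unset Printing Implicit Defensive.

Import GRing.Theory.
Local Open Scope ring_scope.

Section QSeries.
Variable F : fieldType.
Implicit Types (x q z a c : F) (xs : seq F) (i j k l m n : nat).

(* (x; q)_n and (x_1, ..., x_r; q)_n *)
Definition qpoch x q n : F := \prod_(k < n) (1 - x * q ^+ k).

Definition qpochs xs q n : F := \prod_(x <- xs) qpoch x q n.

(* The partial sum over 0 <= k <= n of the 4phi3 series; it is the whole
   series when some upper parameter is q^-n, the later terms being 0. *)
Definition phi43 n (a0 a1 a2 a3 b1 b2 b3 q z : F) : F :=
  \sum_(0 <= k < n.+1)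
    qpochs [:: a0; a1; a2; a3] q k / qpochs [:: q; b1; b2; b3] q k * z ^+ k.

Definition chi k : F := (1 + (-1) ^+ k) / 2.

(* In the first branch n - i - j is an honest difference; when it is odd the
   rounded half (n - i - j)./2 is irrelevant because chi vanishes. Exponents
   of q are integers. *)
Definition Tterm q a c l m n i j : F :=
  if (i + j <= n)%N then
    (-1) ^+ (i + j)
    * q ^ (n%:Z * i%:Z + (n%:Z - i%:Z - j%:Z) * (j%:Z - m%:Z)
           + 'C(j.+1, 2)%:Z)
    * a ^+ i * c ^+ (n - i)
    * ((1 - q ^ (2 * i%:Z - 2 * l%:Z - 1) * a ^+ 2)
       / (1 - q ^ (- 2 * l%:Z - 1) * a ^+ 2))
    * (qpochs [:: q ^ (- l%:Z); q ^ (- n%:Z); q ^ (- 2 * l%:Z - 1) * a ^+ 2] q i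
       / qpochs [:: q; q ^ (n%:Z - 2 * l%:Z) * a ^+ 2;
                    q ^ (- l%:Z) * a ^+ 2] q i)
    * (qpochs [:: q ^ (- m%:Z); q ^ (i%:Z - n%:Z);
                  q ^ (1 + 2 * l%:Z - n%:Z - i%:Z) / a ^+ 2;
                  q ^ (- m%:Z) * c; - q ^ (- m%:Z) * c] q j
       / qpochs [:: q; q ^ (1 + l%:Z - n%:Z) / a; - q ^ (1 + l%:Z - n%:Z) / a;
                    q ^ (- m%:Z) * c ^+ 2;
                    q ^ (j%:Z - 2 * m%:Z - 1) * c ^+ 2] q j)
    * (qpochs [:: q; q ^ (2 + 2 * l%:Z + 2 * m%:Z - 2 * n%:Z)
                     / (a ^+ 2 * c ^+ 2)] (q ^+ 2) (n - i - j)./2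
       / qpochs [:: q ^ (2 + 2 * l%:Z - 2 * n%:Z + 2 * j%:Z) / a ^+ 2;
                    q ^ (1 - 2 * m%:Z + 2 * j%:Z) * c ^+ 2]
                (q ^+ 2) (n - i - j)./2)
    * chi (n - i - j)
  else 0.

End QSeries.

(* Main.v *)
Require Import Defs.
From HB Require Import structures.
From mathcomp Require Import all_boot all_order all_algebra.
From mathcomp Require Import reals complex.
From mathcomp Require Import ring zify.

(** Sears' transformation turns the series into the prefactor of the theorem
    times
      [sum_k (-1)^k [n,k] (c)_k(-ga)_k/(ga c)_k (al)_(n-k)(-a)_(n-k)/(al a)_(n-k)],
    where [al = a q^-l], [ga = c q^-m] and [ [n,k] ] is the Gaussian binomial.
    Both factors of the summand have the same shape and are expanded by a
    terminating very-well-poised 6phi5 sum (over [j] with base parameter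
    [ga^2/q] and over [i] with [al^2/q]). The inner sum over [k] that remains
    for fixed [i], [j] is Andrews' terminating q-Watson sum in the symmetric form
      [sum_(k+v=N) (-1)^k (g;q^2)_k (h;q^2)_v / ((q,g)_k (q,h)_v)],
    which vanishes for odd [N] and is a product for even [N].

    These steps divide by factors that may vanish although every denominator
    of the statement is nonzero. Hence they are carried out at the parameters
    [a t], [c t^2] for all but finitely many [t]; both sides are rational
    functions of [t] without a pole at [t = 1], so equality extends to [t = 1]. *)

Set Implicit Arguments.
Unset Strict Implicit.
Unset Printing Implicit Defensive.

Import Order.TTheory GRing.Theory Num.Theory.
Local Open Scope ring_scope.

Ltac nz := repeat (apply/andP; split);
  first [assumption | exact: oner_neq0 | by apply: expf_neq0 | by rewrite ?oppr_eq0 ?oner_neq0].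

(** * Shifted factorials: splitting, reversal, doubling, and a telescoping principle *)

Section QShiftedFactorial.
Variable F : fieldType.
Implicit Types (q x y : F) (k m n : nat).

Lemma qpochs_nil q n : qpochs [::] q n = 1.
Proof. by rewrite /qpochs big_nil. Qed.

Lemma qpochs_cons x xs q n : qpochs (x :: xs) q n = qpoch x q n * qpochs xs q n.
Proof. by rewrite /qpochs big_cons. Qed.

Lemma qpoch0 x q : qpoch x q 0 = 1.
Proof. by rewrite /qpoch big_ord0. Qed.

Lemma qpochS x q n : qpoch x q n.+1 = qpoch x q n * (1 - x * q ^+ n).
Proof. by rewrite /qpoch big_ord_recr. Qed.

Lemma qpochD x q m n :
  qpoch x q (m + n) = qpoch x q m * qpoch (x * q ^+ m) q n.
Proof.
elim: n => [|n IHn]; first by rewrite addn0 qpoch0 mulr1.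
by rewrite addnS !qpochS IHn exprD !mulrA.
Qed.

Lemma qpochSl x q n : qpoch x q n.+1 = (1 - x) * qpoch (x * q) q n.
Proof. by rewrite -add1n qpochD qpochS qpoch0 mul1r mulr1. Qed.

Lemma qpoch_le_neq0 x q m n :
  (m <= n)%N -> qpoch x q n != 0 -> qpoch x q m != 0.
Proof. by move/subnKC<-; rewrite qpochD mulf_eq0 => /norP[]. Qed.

Lemma qpoch_sub_neq0 x q k m n :
  (k + m <= n)%N -> qpoch x q n != 0 -> qpoch (x * q ^+ k) q m != 0.
Proof.
by move=> /qpoch_le_neq0 h /h; rewrite qpochD mulf_eq0 => /norP[].
Qed.

(** The condition says that [y q^i] and [x q^(k-1-i)] are mutually inverse, so
    [1 - y q^i = - y q^i (1 - x q^(k-1-i))]; the product over [i] reverses the order of the factors.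
    As an equation without inverses, the condition is a goal for [field] at each use. *)
Lemma qpoch_rev x y q k : q != 0 -> x * y * q ^+ k = q ->
  qpoch y q k = (- y) ^+ k * q ^+ 'C(k, 2) * qpoch x q k.
Proof.
move=> q0; elim: k x => [|k IHk] x xyq; first by rewrite !qpoch0 !expr0 !mul1r.
have xyk : x * y * q ^+ k = 1.
  by apply: (mulIf q0); rewrite mul1r -[RHS]xyq exprS; ring.
rewrite qpochS (IHk (x * q)); last by rewrite -[RHS]xyq exprS; ring.
rewrite qpochSl binS bin1 exprD exprS.
transitivity ((- y) ^+ k * q ^+ 'C(k, 2) * qpoch (x * q) q k
   * (x * y * q ^+ k - y * q ^+ k)); first by rewrite xyk.
by ring.
Qed.

Lemma qpoch_sqr x q n : qpoch x q n * qpoch (- x) q n = qpoch (x ^+ 2) (q ^+ 2) n.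
Proof.
rewrite /qpoch -big_split /=; apply: eq_bigr => k _.
by rewrite -exprM mulnC exprM; ring.
Qed.

Lemma exp_bin2D q j r : q ^+ 'C(j + r, 2) = q ^+ 'C(j, 2) * q ^+ 'C(r, 2) * q ^+ (j * r).
Proof.
rewrite -!exprD; congr (_ ^+ _); elim: j => [|j IHj]; first by rewrite bin0n /= mul0n !addn0.
by rewrite addSn !binS !bin1 IHj mulSn; lia.
Qed.

Lemma exp_bin2 q j : q ^+ 'C(j, 2) * q ^+ 'C(j, 2) * q ^+ j = q ^+ (j * j).
Proof.
rewrite -!exprD; congr (_ ^+ _); elim: j => [|j IHj] //.
by rewrite !binS !bin1 mulSn mulnS; lia.
Qed.

(* Creative telescoping: [G] is a certificate for a first-order recurrence in
   [N] of the sums of [f] over [j + r = N]. *)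
Lemma pascal_telescope (f G : nat -> nat -> F) (al be : F) N :
  (forall j r, (j + r)%N = N ->
     al * f j r.+1 - be * f j r = G j.+1 r - G j r.+1) ->
  al * f N.+1 0%N = - G N.+1 0%N -> G 0%N N.+1 = 0 ->
  al * (\sum_(0 <= j < N.+2) f j (N.+1 - j)%N)
    = be * (\sum_(0 <= j < N.+1) f j (N - j)%N).
Proof.
move=> rec top bot; rewrite big_nat_recr //= subnn mulrDr top.
apply/eqP; rewrite -subr_eq0 addrAC !mulr_sumr -sumrB; apply/eqP.
rewrite (eq_big_nat _ _ (F2 := fun j => G j.+1 (N.+1 - j.+1)%N - G j (N.+1 - j)%N)).
  by rewrite (telescope_sumr (fun j => G j (N.+1 - j)%N)) // subnn subn0 bot subr0 subrr.
move=> j /andP[_ le_jN]; rewrite subSS subSn // rec //; exact: subnKC.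
Qed.

End QShiftedFactorial.

#[local] Opaque qpoch.

(** * Three terminating summations proved by creative telescoping *)

Section Summations.
Variables (F : fieldType) (q : F).
Hypothesis q_neq0 : q != 0.
Implicit Types (b g h t : F).
Local Notation qp x n := (qpoch x q n) (only parsing).

Lemma qfact_neq0 n : qp q n.+1 != 0 -> qp q n != 0 /\ 1 - q * q ^+ n != 0.
Proof. by rewrite qpochS mulf_eq0 => /norP[]. Qed.

Definition saalschutz_term (p x y : F) j r : F :=
  qp x j * qp y j * qp (p * x * y * q ^+ j) r * qp p r * p ^+ j
    / (qp q j * qp q r).

(* The q-Pfaff-Saalschutz sum with its denominators cleared. *)
Lemma saalschutz_poly (p x y : F) k : qp q k != 0 ->
  \sum_(0 <= j < k.+1) saalschutz_term p x y j (k - j)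
    = qp (p * x) k * qp (p * y) k / qp q k.
Proof.
elim: k => [_|k IHk qk]; first by rewrite big_nat1 /saalschutz_term subnn !qpoch0 expr0 !mul1r.
have [qk0 qk1] := qfact_neq0 qk.
(* The multipliers [1 - q^(k+1)] and [(1 - p x q^k)(1 - p y q^k)] are read off from the quotient of
   the closed forms at [k+1] and [k]. The factor [1 - q^j] of the certificate makes it vanish at
   [j = 0]. *)
apply: (mulfI qk1); rewrite (@pascal_telescope _ (saalschutz_term p x y)
  (fun j r => - q ^+ r * (1 - q ^+ j) * (qp x j * qp y j
     * qp (p * x * y * q ^+ j / q) r * qp p r * p ^+ j / (qp q j * qp q r)))
  _ ((1 - p * x * q ^+ k) * (1 - p * y * q ^+ k))).
- rewrite IHk // !qpochS.
  by field; rewrite qk0 qk1.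
- move=> j r jr; rewrite /saalschutz_term.
  have [qj qr] : qp q j.+1 != 0 /\ qp q r.+1 != 0.
    by split; apply: qpoch_le_neq0 qk; rewrite ltnS -jr ?leq_addr ?leq_addl.
  rewrite !exprS (qpochSl (p * x * y * q ^+ j / q)) (_ : _ / q * q = p * x * y * q ^+ j); last by rewrite mulfVK.
  rewrite (_ : p * x * y * (q * q ^+ j) / q = p * x * y * q ^+ j); last by field.
  have [qj0 qj1] := qfact_neq0 qj; have [qr0 qr1] := qfact_neq0 qr.
  rewrite !qpochS -jr exprD.
  set u := q ^+ j in qj1 *; set w := q ^+ r in qr1 *.
  by field; rewrite qj0 qj1 qr0 qr1 q_neq0.
- rewrite /saalschutz_term !qpoch0 expr0 -exprS; by ring.
by rewrite expr0 subrr !(mulr0, mul0r).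
Qed.

(** With [A = (b t)^2 / q] and [k = j + r], the first factor is the very-well-poised [1 - A q^(2j)].
    The factorial [(q^-k)_j] is absorbed in [(q)_r], while [(A)_j] and [(A q^(k+1))_j] are absorbed
    in [(A q^j)_(k+1)], up to factors that depend on [k] alone and powers. *)
Definition vwp_term b t j r : F :=
  (1 - (b * t) ^+ 2 * q ^+ j * q ^+ j / q) * qp b j * (- t) ^+ j * q ^+ 'C(j, 2)
    / (qp q j * qp q r * qp (b * t ^+ 2) j * qp ((b * t) ^+ 2 * q ^+ j / q) ((j + r).+1)).

(* The terminating 6phi5 sum with base parameter [A = (b t)^2 / q] and upper
   parameters [b], [q^-k], [b t]; since [A q / (b t) = b t], the last one
   cancels and the summand is rational in [b] and [t]. *)
Lemma vwp_sum b t k : qp q k != 0 -> qp (b * t) k != 0 ->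
  qp (b * t ^+ 2) k != 0 ->
  (forall j, (j <= k)%N -> qp ((b * t) ^+ 2 * q ^+ j / q) k.+1 != 0) ->
  \sum_(0 <= j < k.+1) vwp_term b t j (k - j)
    = qp t k / (qp q k * qp (b * t ^+ 2) k * qp (b * t) k).
Proof.
elim: k => [_ _ _ /(_ 0%N isT)|k IHk qk sk sbk vk].
  rewrite big_nat1 /vwp_term subnn bin0n !qpochS !qpoch0 !expr0 !mulr1 !mul1r => h.
  by rewrite !invr1 mulfV.
have [qk0 qk1] := qfact_neq0 qk.
have [sk0 sk1] : qp (b * t) k != 0 /\ 1 - b * t * q ^+ k != 0.
  by move: sk; rewrite qpochS mulf_eq0 => /norP[].
have [sbk0 sbk1] : qp (b * t ^+ 2) k != 0 /\ 1 - b * t ^+ 2 * q ^+ k != 0.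
  by move: sbk; rewrite qpochS mulf_eq0 => /norP[].
have vk0 j : (j <= k)%N -> qp ((b * t) ^+ 2 * q ^+ j / q) k.+1 != 0.
  by move=> le_jk; apply: (qpoch_le_neq0 (leqnSn _)) (vk _ (leqW le_jk)).
have al0 : (1 - q * q ^+ k) * (1 - b * t ^+ 2 * q ^+ k) * (1 - b * t * q ^+ k) != 0.
  by rewrite !mulf_neq0.
(* The multipliers again come from the quotient of consecutive closed forms. In the certificate the
   last factorial has [j + r] factors instead of [j + r + 1], so that neighbouring terms share their
   common factors. *)
apply: (mulfI al0); rewrite (@pascal_telescope _ (vwp_term b t)
  (fun j r => - (q ^+ r - b * t * q ^+ j * q ^+ r / q) * (1 - q ^+ j)
     * (1 - b * t ^+ 2 * q ^+ j / q) * (qp b j * (- t) ^+ j * q ^+ 'C(j, 2)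
    / (qp q j * qp q r * qp (b * t ^+ 2) j * qp ((b * t) ^+ 2 * q ^+ j / q) (j + r))))
  _ (1 - t * q ^+ k)).
- rewrite IHk // !qpochS.
  by field; rewrite ?(sk0, sk1, qk0, qk1, sbk0, sbk1).
- move=> j r jr; rewrite /vwp_term.
  have [qj qr] : qp q j.+1 != 0 /\ qp q r.+1 != 0.
    by split; apply: qpoch_le_neq0 qk; rewrite ltnS -jr ?leq_addr ?leq_addl.
  have [qj0 qj1] := qfact_neq0 qj; have [qr0 qr1] := qfact_neq0 qr.
  have [sbj0 sbj1] : qp (b * t ^+ 2) j != 0 /\ 1 - b * t ^+ 2 * q ^+ j != 0.
    apply/andP; rewrite -negb_or -mulf_eq0 -qpochS; by apply: qpoch_le_neq0 sbk; rewrite ltnS -jr leq_addr.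
  have /vk : (j <= k.+1)%N by rewrite -jr -addnS leq_addr.
  have /vk : (j.+1 <= k.+1)%N by rewrite ltnS -jr leq_addr.
  rewrite addSn addnS jr.
  rewrite (_ : (b * t) ^+ 2 * q ^+ j.+1 / q = (b * t) ^+ 2 * q ^+ j); last by rewrite (exprS q); field.
  rewrite !(qpochSl ((b * t) ^+ 2 * q ^+ j / q)) mulfVK //.
  rewrite !(qpochS ((b * t) ^+ 2 * q ^+ j)) !mulf_eq0 !negb_or.
  case/andP=> /andP[v1 v2] _ /and3P[v3 _ _].
  move: (qp ((b * t) ^+ 2 * q ^+ j) k) v1 v2 => X0 v1.
  rewrite binS bin1 !qpochS -jr exprD !(exprS q) exprD [(- t) ^+ _.+1]exprS.
  move: (q ^+ 'C(j, 2)) qj1 qr1 sbj1 v3 => C.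
  move: (qp b j) (qp q j) (qp q r) ((- t) ^+ j : F)
    (qp (b * t ^+ 2) j) qj0 qr0 sbj0 (q ^+ j) (q ^+ r).
  move=> X2 X3 X4 X5 X6 qj0 qr0 sbj0 u w qj1 qr1 sbj1 v3 v2.
  have v3' : q - (b * t) ^+ 2 * u != 0.
    rewrite (_ : _ - _ = q * (1 - (b * t) ^+ 2 * u / q)); [exact: mulf_neq0 | by field].
  field.
  by rewrite q_neq0 qj0 qr0 qr1 qj1 sbj0 sbj1 v1 v2 v3'.
- have := vk _ (leqnn _); rewrite /vwp_term !addn0 qpoch0 [qp _ k.+2]qpochS mulf_eq0 negb_or.
  move: (qp ((b * t) ^+ 2 * q ^+ k.+1 / q) k.+1) => X0; rewrite (qpochS q) (qpochS (b * t ^+ 2)).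
  move: (qp b k.+1) ((- t) ^+ k.+1 : F) (q ^+ 'C(k.+1, 2)) => X1 X2 X3; rewrite expr0 (exprS q).
  move: (q ^+ k) qk1 sk1 sbk1 => Q qk1 sk1 sbk1 /andP[v1 v2].
  have v2' : 1 - (b * t) ^+ 2 * Q * (q * Q) != 0.
    by rewrite (_ : _ * Q = (b * t) ^+ 2 * (q * Q) / q) //; field.
  field.
  by rewrite q_neq0 qk0 qk1 sbk0 sbk1 v1 v2'.
by rewrite expr0 subrr !(mulr0, mul0r).
Qed.

(** This is the part of a very-well-poised expansion that still depends on the outer summation
    index; see [xfac_expand]. *)
Definition efac g k : F := qpoch g (q ^+ 2) k / (qp q k * qp g k).

Definition wterm g h k v : F := (-1) ^+ k * efac g k * efac h v.

Definition wsum g h n := \sum_(0 <= k < n.+1) wterm g h k (n - k).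

(* The certificate [rho] was found from the ansatz of a Laurent polynomial in
   [q ^+ k] of degree at most 1 in both directions. *)
Lemma wsum_rec g h n :
  qp q n.+2 != 0 -> qp g n.+2 != 0 -> qp h n.+2 != 0 ->
  (1 - q ^+ n.+2) * (1 - g * q ^+ n.+1) * (1 - h * q ^+ n.+1)
      * (1 - g * h * q ^+ n) * wsum g h n.+2
    = (1 - g * h * q ^+ n.*2) * (1 - g * h * q ^+ n.+1.*2) * wsum g h n.
Proof.
move=> qn gn hn.
pose rho (k v : nat) : F := let x := q ^+ k.+1 in let y := q ^+ v in
  let hw := h * g * (x * y) ^+ 2 / q ^+ 2 in
  (hw * (1 + h / q) - h * (x * y) / q * (1 + g / q)) * y
  + (1 - hw) * (1 + hw / q)
  - g * (x * y) * x / q ^+ 2 * (1 + h / q - h * (x * y) / q * (1 + g / q)).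
pose G k v := rho k v * wterm g h k v.
(* The recurrence has step two: the term at [(j+1, r+1)] is compared with the one at [(j, r)]. The
   two end terms of the longer sum have no partner; [bot] and [top] match them with the ends of the
   telescoping sum. *)
have rec j r : (j + r)%N = n ->
  (1 - q ^+ n.+2) * (1 - g * q ^+ n.+1) * (1 - h * q ^+ n.+1)
    * (1 - g * h * q ^+ n) * wterm g h j.+1 r.+1
    = (1 - g * h * q ^+ n.*2) * (1 - g * h * q ^+ n.+1.*2) * wterm g h j r
    + (G j.+1 r - G j r.+1).
  move=> jr.
  have le_j : (j.+1 <= n.+2)%N by rewrite ltnS -jr -addnS leq_addr.
  have le_r : (r.+1 <= n.+2)%N by rewrite ltnS -jr -addSn leq_addl.
  have := qpoch_le_neq0 le_j qn; have := qpoch_le_neq0 le_r qn.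
  have := qpoch_le_neq0 le_j gn; have := qpoch_le_neq0 le_r hn.
  rewrite /G /rho /wterm /efac doubleS -jr -addnn !qpochS -!exprM !mul2n -!addnn.
  rewrite !(exprS q) !exprD [(-1) ^+ j.+1]exprS !mulf_eq0 !negb_or.
  move: (qp h r) (qp g j) (qp q r) (qp q j) (qpoch g _ j) (qpoch h _ r) ((-1) ^+ j : F) (q ^+ j) (q ^+ r).
  move=> X1 X2 X3 X4 X5 X6 X7 u w /andP[x1 e1] /andP[x2 e2] /andP[x3 e3] /andP[x4 e4].
  field.
  by rewrite q_neq0 e1 e2 e3 e4 x1 x2 x3 x4.
set al := _ * (1 - g * h * q ^+ n) in rec *; set be := _ * (1 - g * h * q ^+ n.+1.*2) in rec *.
have bot : al * wterm g h 0 n.+2 = G 0%N n.+1.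
  rewrite /al /G /rho /wterm /efac !(qpochS _ _ n.+1) !qpoch0 -exprM mulnC exprM.
  move: qn hn; rewrite !qpochS !mulf_eq0 !negb_or !(exprS q) !expr0.
  move: (qp h n) (qp q n) (qpoch h (q ^+ 2) n) (q ^+ n) => X1 X2 X3 u.
  move=> /andP[/andP[e1 e2] e3] /andP[/andP[e4 e5] e6].
  field.
  by rewrite q_neq0 oner_neq0 e1 e2 e3 e4 e5 e6.
have top : al * wterm g h n.+2 0 = - G n.+1 0%N.
  rewrite /al /G /rho /wterm /efac !(qpochS _ _ n.+1) !qpoch0 -exprM mulnC exprM [(-1) ^+ n.+2]exprS.
  move: qn gn; rewrite !qpochS !mulf_eq0 !negb_or !(exprS q) !expr0.
  move: (qp g n) (qp q n) (qpoch g (q ^+ 2) n) ((-1) ^+ n.+1 : F) (q ^+ n) => X1 X2 X3 X4 u.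
  move=> /andP[/andP[e1 e2] e3] /andP[/andP[e4 e5] e6].
  field.
  by rewrite q_neq0 oner_neq0 e1 e2 e3 e4 e5 e6.
rewrite /wsum big_nat_recl // big_nat_recr //= subn0 subnn [LHS]mulrDr [X in _ + X]mulrDr bot top.
rewrite mulr_sumr (eq_big_nat _ _ (F2 := fun j => be * wterm g h j (n - j)
    + (G j.+1 (n.+1 - j.+1)%N - G j (n.+1 - j)%N))); last first.
  by move=> j /andP[_ le_jn]; rewrite !subSS subSn // rec // subnKC.
rewrite big_split /= -mulr_sumr (telescope_sumr (fun j => G j (n.+1 - j)%N)) // subnn subn0.
by ring.
Qed.

Lemma wsum_step g h n :
  qp q n.+2 != 0 -> qp g n.+2 != 0 -> qp h n.+2 != 0 -> 1 - g * h * q ^+ n != 0 ->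
  wsum g h n.+2 = (1 - g * h * q ^+ n.*2) * (1 - g * h * q ^+ n.+1.*2) * wsum g h n
    / ((1 - q ^+ n.+2) * (1 - g * q ^+ n.+1) * (1 - h * q ^+ n.+1) * (1 - g * h * q ^+ n)).
Proof.
move=> qn gn hn gh; rewrite -wsum_rec // mulrAC mulfV ?mul1r //.
move: qn gn hn; rewrite !(qpochS _ _ n.+1) -exprS !(mulf_eq0, negb_or).
by move=> /andP[_ ->] /andP[_ ->] /andP[_ ->].
Qed.

Lemma wsum_odd g h p :
  qp q p.*2.+1 != 0 -> qp g p.*2.+1 != 0 -> qp h p.*2.+1 != 0 -> qp (g * h) p.*2.+1 != 0 ->
  wsum g h p.*2.+1 = 0.
Proof.
elim: p => [|p IHp].
  (* For [N = 1] both terms are [1 / (1 - q)] up to opposite signs. The recurrence then carries the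
     zero to all odd [N]. *)
  rewrite !qpochS !qpoch0 !mul1r !expr0 !mulr1 => q1 g1 h1 _.
  rewrite /wsum big_nat_recr //= big_nat1 /wterm /efac !qpochS !qpoch0 !mul1r !expr0 !mulr1.
  by field; rewrite q1 g1 h1 oner_neq0.
rewrite doubleS => qn gn hn ghn.
have le2 (x : F) k : qp x k.+2 != 0 -> qp x k != 0.
  by apply: qpoch_le_neq0; rewrite leqW.
have gh : 1 - g * h * q ^+ p.*2.+1 != 0.
  by move: ghn; rewrite !(qpochS (g * h)) !mulf_eq0 !negb_or => /andP[/andP[_ ->]].
by rewrite (wsum_step qn gn hn gh) (IHp (le2 _ _ qn) (le2 _ _ gn) (le2 _ _ hn) (le2 _ _ ghn)) mulr0 mul0r.
Qed.

Lemma wsum_even g h p :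
  qp q p.*2 != 0 -> qp g p.*2 != 0 -> qp h p.*2 != 0 -> qp (g * h) p.*2 != 0 ->
  wsum g h p.*2 = qpoch (g * h * q ^+ p.*2) (q ^+ 2) p
    / (qpoch (q ^+ 2) (q ^+ 2) p * qpoch (q * g) (q ^+ 2) p * qpoch (q * h) (q ^+ 2) p).
Proof.
elim: p => [|p IHp].
  by rewrite /wsum big_nat1 /wterm /efac subnn !qpoch0 expr0 !mulr1 invr1 !mulr1.
rewrite doubleS => qn gn hn ghn.
have le2 (x : F) k : qp x k.+2 != 0 -> qp x k != 0.
  by apply: qpoch_le_neq0; rewrite leqW.
have gh : 1 - g * h * q ^+ p.*2 != 0.
  by move: ghn; rewrite !(qpochS (g * h)) !mulf_eq0 !negb_or => /andP[/andP[_ ->]].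
rewrite (wsum_step qn gn hn gh) (IHp (le2 _ _ qn) (le2 _ _ gn) (le2 _ _ hn) (le2 _ _ ghn)).
(* The numerator factorial moves its starting point as [p] grows: it loses its first factor and
   gains two at the end. Both splittings of the factorial of length [p + 2] express this. *)
have := qpochSl (g * h * q ^+ p.*2) (q ^+ 2) p.+1.
rewrite (qpochS _ _ p.+1) (qpochS _ _ p) -exprM mul2n -[_ * q ^+ 2]mulrA -exprD addn2 => gh3.
rewrite (_ : qpoch _ _ p.+1 =
  (qpoch (g * h * q ^+ p.*2) (q ^+ 2) p * (1 - g * h * q ^+ p.*2 * q ^+ p.*2)
   * (1 - g * h * q ^+ p.*2 * (q ^+ 2) ^+ p.+1)) / (1 - g * h * q ^+ p.*2)); last first.
  by rewrite gh3 [_ * qpoch _ _ _]mulrC mulfK.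
rewrite !(qpochS _ _ p) -!exprM !mul2n !doubleS !invfM.
move: (qpoch (q ^+ 2) (q ^+ 2) p)^-1 (qpoch (q * g) (q ^+ 2) p)^-1
  (qpoch (q * h) (q ^+ 2) p)^-1 (qpoch (g * h * q ^+ p.*2) (q ^+ 2) p) => X1 X2 X3 X4.
move: qn gn hn gh; rewrite !(qpochS _ _ p.*2.+1) !mulf_eq0 !negb_or !(exprS q).
rewrite -!addnn !exprD expr0; move: (q ^+ p) => u /andP[_ e1] /andP[_ e2] /andP[_ e3] e4.
field.
by rewrite -(mulrA q h) (mulrCA q h) e3 -(mulrA q g) (mulrCA q g) e2 -(mulrA q q) e1.
Qed.
End Summations.

(** * Rearrangement and truncation of double sums *)

Section Triangular.
Variable V : zmodType.
Implicit Type f : nat -> nat -> V.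

Lemma sum_triangle f n :
  \sum_(0 <= k < n.+1) \sum_(0 <= j < k.+1) f j (k - j)%N
    = \sum_(0 <= j < n.+1) \sum_(0 <= r < (n - j).+1) f j r.
Proof.
elim: n => [|n IHn]; first by rewrite !big_nat1.
rewrite big_nat_recr // IHn /= [RHS]big_nat_recr //= subnn big_nat1.
rewrite [X in _ + X]big_nat_recr //= subnn addrA -big_split /=; congr (_ + _).
by apply: eq_big_nat => j /andP[_ le_jn]; rewrite subSn // [RHS]big_nat_recr.
Qed.

Lemma sum_triangleC f n :
  \sum_(0 <= j < n.+1) \sum_(0 <= r < (n - j).+1) f j r
    = \sum_(0 <= r < n.+1) \sum_(0 <= j < (n - r).+1) f j r.
Proof.
rewrite -sum_triangle -(sum_triangle (fun r j => f j r)).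
apply: eq_big_nat => k _; rewrite big_nat_rev /= add0n.
by apply: eq_big_nat => j /andP[_ le_jk]; rewrite subSS subKn.
Qed.

Lemma sum_nat_trunc (f : nat -> V) a N : (a <= N)%N ->
  (forall k, (a <= k)%N -> f k = 0) -> \sum_(0 <= k < N) f k = \sum_(0 <= k < a) f k.
Proof.
move=> le_aN f0; rewrite (big_cat_nat (n := a)) //= [X in _ + X]big_nat_cond [X in _ + X]big1 ?addr0 //.
by move=> k /andP[/andP[le_ak _] _]; apply: f0.
Qed.

End Triangular.

(** * The q-Pfaff-Saalschutz sum in series form and Sears' transformation *)

Section Transformations.
Variables (F : fieldType) (q : F).
Hypothesis q_neq0 : q != 0.
Local Notation qp x n := (qpoch x q n) (only parsing).

(** In the quotient of two reversals of equal length the sign and [q^C(k,2)] cancel, and only the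
    powers of [y1] and [y2] survive. *)
Lemma qpoch_rev2 (x1 y1 x2 y2 : F) k :
  x1 * y1 * q ^+ k = q -> x2 * y2 * q ^+ k = q ->
  qp y1 k * qp x2 k * y2 ^+ k = qp y2 k * qp x1 k * y1 ^+ k.
Proof.
move=> h1 h2; rewrite (qpoch_rev q_neq0 h1) (qpoch_rev q_neq0 h2).
by rewrite [(- y1) ^+ k]exprNn [(- y2) ^+ k]exprNn; ring.
Qed.

(** Reversal against [x = q^(r+1)], whose factorial is [(q)_n / (q)_r]; this is how [(q^-n)_j]
    yields a Gaussian binomial. *)
Lemma qpoch_qVn (n j r : nat) : (j + r)%N = n ->
  qp ((q ^+ n)^-1) j * qp q r = (- (q ^+ n)^-1) ^+ j * q ^+ 'C(j, 2) * qp q n.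
Proof.
move=> jrn; have e : q * q ^+ r * (q ^+ n)^-1 * q ^+ j = q.
  by rewrite -jrn exprD; field; rewrite !expf_neq0.
by rewrite (qpoch_rev q_neq0 e) -jrn addnC qpochD; ring.
Qed.

(** The hypothesis on [d] is the balancing condition. Reversing [(q^-n)_k] and [(p)_(n-k)] turns
    each summand into a constant multiple of [saalschutz_term]. *)
Lemma saalschutz (p x y d : F) n : p * d * q ^+ n = q ->
  qp q n != 0 -> qp (p * x * y) n != 0 -> qp d n != 0 ->
  \sum_(0 <= k < n.+1) qp ((q ^+ n)^-1) k * qp x k * qp y k * q ^+ k
      / (qp q k * qp (p * x * y) k * qp d k)
    = qp (p * x) n * qp (p * y) n / (qp (p * x * y) n * qp p n).
Proof.
move=> pd qn cn dn.
have p0 : p != 0 by apply: contraNneq q_neq0 => p0; rewrite -pd p0 !mul0r.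
have pn := qpoch_rev q_neq0 (etrans (congr1 (fun z => z * q ^+ n) (mulrC d p)) pd).
have pn0 : qp p n != 0 by rewrite pn !mulf_neq0 ?expf_neq0 ?oppr_eq0.
have k0 : qp q n / (qp (p * x * y) n * qp p n) != 0.
  by rewrite mulf_neq0 ?invr_neq0 ?mulf_neq0.
transitivity (qp q n / (qp (p * x * y) n * qp p n) * (qp (p * x) n * qp (p * y) n / qp q n)); last first.
  by field; rewrite qn cn pn0.
rewrite -saalschutz_poly // mulr_sumr; apply: eq_big_nat => k /andP[_]; rewrite ltnS => le_kn.
rewrite /saalschutz_term; set r := (n - k)%N.
have kr : (k + r)%N = n by rewrite subnKC.
have le_rn : (r <= n)%N by rewrite leq_subr.
have qk := qpoch_le_neq0 le_kn qn; have qr := qpoch_le_neq0 le_rn qn.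
have -> : qp ((q ^+ n)^-1) k = (- (q ^+ n)^-1) ^+ k * q ^+ 'C(k, 2) * qp q n / qp q r.
  by rewrite -(qpoch_qVn kr) mulfK.
have -> : qp p r = (- p) ^+ r * q ^+ 'C(r, 2) * qp (d * q ^+ k) r.
  apply: qpoch_rev => //; rewrite -[RHS]pd -kr exprD; ring.
rewrite pn; move: cn dn; rewrite -kr !(qpochD _ _ k) !mulf_eq0 !negb_or exp_bin2D.
rewrite [(- _^-1) ^+ k]exprNn exprVn ![(- p) ^+ _]exprNn.
rewrite -exprM mulnDl (mulnC r) [q ^+ (k * k + _)]exprD -exp_bin2.
case/andP=> c1 c2 /andP[d1 d2]; rewrite [p ^+ (k + r)]exprD [(-1) ^+ (k + r)]exprD.
rewrite -[(-1) ^+ k]signr_odd; have := negbT (signr_eq0 F r).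
move: ((-1) ^+ r : F) => X0 x0.
move: (qp (d * q ^+ k) r) d2 (qp (p * x * y * q ^+ k) r) c2 (qp q r) qr => X1 x1 X2 x2 X3 x3.
move: (qp q k) qk (qp (p * x * y) k) c1 (qp d k) d1 => X4 x4 X5 x5 X6 x6.
have pk := expf_neq0 k p0; have pr := expf_neq0 r p0.
have qs m := expf_neq0 m q_neq0.
move: (p ^+ k) pk (p ^+ r) pr (q ^+ 'C(k, 2)) (qs 'C(k, 2)) (q ^+ 'C(r, 2)) (qs 'C(r, 2)) => X7 x7 X8 x8 X9 x9 X10 x10.
move: (q ^+ (k * r)) (qs (k * r)%N) (q ^+ k) (qs k) => X11 x11 X12 x12.
(* The sides carry [(-1)^k] and its inverse; fixing the parity of [k] lets [field] identify them. *)
case: (odd k); rewrite ?expr0 ?expr1; field; nz.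
Qed.

(* In the usual notation the lower parameters are [d = p x y], [e = a u],
   [f = a v] and the remaining upper ones [b = p y], [c = p x]; the definition
   of [p] is the balancing condition. *)
Lemma sears (a x y u v : F) n : a != 0 -> u != 0 -> v != 0 ->
  qp q n != 0 -> qp (a * u) n != 0 -> qp (a * v) n != 0 ->
  qp (q / (q ^+ n * u)) n != 0 -> qp (q / (q ^+ n * v)) n != 0 ->
  let p := a * u * v * q ^+ n / q in
  qp (p * x * y) n != 0 ->
  \sum_(0 <= k < n.+1) qp ((q ^+ n)^-1) k * qp a k * qp (p * y) k * qp (p * x) k * q ^+ k
      / (qp q k * qp (p * x * y) k * qp (a * u) k * qp (a * v) k)
  = a ^+ n * qp u n * qp v n / (qp (a * u) n * qp (a * v) n) *
    \sum_(0 <= j < n.+1) qp ((q ^+ n)^-1) j * qp a j * qp x j * qp y j * q ^+ j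
      / (qp q j * qp (p * x * y) j * qp (q / (q ^+ n * u)) j * qp (q / (q ^+ n * v)) j).
Proof.
move=> a0 u0 v0 qn aun avn qun qvn p.
have pE : p = a * u * v * q ^+ n / q by [].
clearbody p => pxyn.
pose U j := qp ((q ^+ n)^-1) j * qp a j * qp x j * qp y j * (p * q) ^+ j
  / (qp q j * qp (p * x * y) j * qp (a * u) j * qp (a * v) j).
pose V j r := qp ((q ^+ (n - j))^-1) r * qp (a * q ^+ j) r * qp p r * q ^+ r
  / (qp q r * qp (a * u * q ^+ j) r * qp (a * v * q ^+ j) r).
(* The product [(p x)_k (p y)_k / (q)_k] is expanded by [saalschutz_poly]. After the exchange of
   summations the inner sum of [V j] over [r] is again a Saalschutz sum. *)
transitivity (\sum_(0 <= k < n.+1) \sum_(0 <= j < k.+1) U j * V j (k - j)%N).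
  apply: eq_big_nat => k /andP[_]; rewrite ltnS => le_kn.
  have qk := qpoch_le_neq0 le_kn qn.
  transitivity (qp ((q ^+ n)^-1) k * qp a k * q ^+ k /
     (qp (p * x * y) k * qp (a * u) k * qp (a * v) k) * (qp (p * x) k * qp (p * y) k / qp q k)).
    have h1 := qpoch_le_neq0 le_kn pxyn; have h2 := qpoch_le_neq0 le_kn aun.
    have h3 := qpoch_le_neq0 le_kn avn.
    by field; nz.
  rewrite -saalschutz_poly // mulr_sumr; apply: eq_big_nat => j /andP[_]; rewrite ltnS => le_jk.
  rewrite /U /V /saalschutz_term; set r := (k - j)%N.
  have jrk : (j + r)%N = k by rewrite subnKC.
  rewrite (_ : (q ^+ (n - j))^-1 = (q ^+ n)^-1 * q ^+ j); last first.
    by rewrite -[n in RHS](subnKC (leq_trans le_jk le_kn)) exprD; field; rewrite !expf_neq0.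
  have := qpoch_le_neq0 le_kn pxyn; have := qpoch_le_neq0 le_kn aun.
  have := qpoch_le_neq0 le_kn avn; move: (qpoch_le_neq0 (leq_subr j k : (r <= k)%N) qk) (qpoch_le_neq0 le_jk qk).
  rewrite -jrk !(qpochD _ _ j) !mulf_eq0 !negb_or [(p * q) ^+ j]exprMn exprD.
  move=> qr qj /andP[h1 h2] /andP[h3 h4] /andP[h5 h6].
  by field; nz.
rewrite (sum_triangle (fun j r => U j * V j r)) mulr_sumr.
apply: eq_big_nat => j /andP[_]; rewrite ltnS => le_jn.
rewrite -mulr_sumr; set r := (n - j)%N.
have jrn : (j + r)%N = n by rewrite subnKC.
have qn0 := expf_neq0 n q_neq0.
(* This is the value forced by the balancing condition of the inner sum, of length [n - j] and with
   [d = a v q^j]. *)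
pose p' := q / (q ^+ n * (a * v)).
have p'xy : p' * (a * q ^+ j) * p = a * u * q ^+ j by rewrite /p' pE; field; nz.
have p'x : p' * (a * q ^+ j) = q * q ^+ j / (q ^+ n * v) by rewrite /p'; field; nz.
have p'y : p' * p = u by rewrite /p' pE; field; nz.
have -> : \sum_(0 <= r0 < r.+1) V j r0
  = qp (q * q ^+ j / (q ^+ n * v)) r * qp u r / (qp (a * u * q ^+ j) r * qp p' r).
  rewrite -p'x -[in RHS]p'xy -{1}p'y -(saalschutz (d := a * v * q ^+ j)).
  - by apply: eq_bigr => i _; rewrite /V p'xy.
  - by rewrite /p' -jrn exprD; field; nz.
  - by apply: qpoch_le_neq0 qn; rewrite leq_subr.
  - by rewrite p'xy; apply: qpoch_sub_neq0 aun; rewrite jrn.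
  by apply: qpoch_sub_neq0 avn; rewrite jrn.
(* Balance of pure powers: [(p q)^j] comes from [U], [(a q^j)^r] from the reversal [R3], and the
   denominator on the right from the reversals [R1] and [R2]. *)
have S : (p * q) ^+ j * (a * q ^+ j) ^+ r
  = a ^+ n * q ^+ j / ((q / (q ^+ n * u)) ^+ j * (q / (q ^+ n * v)) ^+ j * q ^+ 'C(j, 2) ^+ 2).
  rewrite pE -jrn -[q ^+ 'C(j, 2) ^+ 2]mulr1 -[1](mulfV (expf_neq0 j q_neq0)).
  rewrite [q ^+ 'C(j, 2) ^+ 2 * _]mulrA expr2 exp_bin2.
  rewrite !exprMn !exprVn !exprMn -!exprM mulnDl !exprD (mulnC r j).
  have qs m := expf_neq0 m q_neq0.
  have := expf_neq0 j a0; have := expf_neq0 j u0; have := expf_neq0 j v0.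
  move: (q ^+ (j * j)) (qs (j * j)%N) (q ^+ (j * r)) (qs (j * r)%N) (q ^+ j) (qs j).
  move: (a ^+ j) (u ^+ j) (v ^+ j) => X1 X2 X3 X4 x4 X5 x5 X6 x6 x3 x2 x1.
  by field; nz.
have R1 : qp (q / (q ^+ n * u)) j = (-1) ^+ j * (q / (q ^+ n * u)) ^+ j * q ^+ 'C(j, 2) * qp (u * q ^+ r) j.
  by rewrite -exprNn; apply: qpoch_rev => //; rewrite -jrn exprD; field; nz.
have R2 : qp (q / (q ^+ n * v)) j = (-1) ^+ j * (q / (q ^+ n * v)) ^+ j * q ^+ 'C(j, 2) * qp (v * q ^+ r) j.
  by rewrite -exprNn; apply: qpoch_rev => //; rewrite -jrn exprD; field; nz.
have R3 : qp (q * q ^+ j / (q ^+ n * v)) r * qp (a * v * q ^+ j) r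
    = qp p' r * qp v r * (a * q ^+ j) ^+ r.
  have p'0 : p' ^+ r != 0 by rewrite expf_neq0 // /p' !mulf_neq0 // invr_neq0 // !mulf_neq0.
  apply: (mulIf p'0); rewrite -[RHS]mulrA -exprMn [_ * p']mulrC p'x.
  by apply/esym/qpoch_rev2; rewrite /p' -jrn exprD; field; nz.
have p'n : qp p' r != 0.
  have e : a * v * q ^+ j * p' * q ^+ r = q by rewrite /p' -jrn exprD; field; nz.
  rewrite (qpoch_rev q_neq0 e) !mulf_neq0 ?expf_neq0 ?oppr_eq0 //.
    by rewrite /p' !mulf_neq0 // invr_neq0 // !mulf_neq0.
  by apply: qpoch_sub_neq0 avn; rewrite jrn.
have E1 z : qp z n = qp z r * qp (z * q ^+ r) j by rewrite -qpochD addnC jrn.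
have E2 z : qp z n = qp z j * qp (z * q ^+ j) r by rewrite -qpochD jrn.
have qj := qpoch_le_neq0 le_jn qn; have pj := qpoch_le_neq0 le_jn pxyn.
move: aun avn (qpoch_le_neq0 le_jn qun) (qpoch_le_neq0 le_jn qvn).
rewrite (E1 u) (E1 v) !E2 R1 R2 /U !mulf_eq0 !negb_or.
case/andP=> h1 h2 /andP[h3 h4] /andP[/andP[/andP[_ h10] h11] h6] /andP[/andP[/andP[_ h12] _] h9].
transitivity (qp (q ^+ n)^-1 j * qp a j * qp x j * qp y j * ((p * q) ^+ j * (a * q ^+ j) ^+ r)
  / (qp q j * qp (p * x * y) j * qp (a * u) j * qp (a * v) j)
  * (qp u r * qp v r / (qp (a * u * q ^+ j) r * qp (a * v * q ^+ j) r))).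
  rewrite (_ : qp (q * q ^+ j / (q ^+ n * v)) r = qp p' r * qp v r * (a * q ^+ j) ^+ r / qp (a * v * q ^+ j) r).
    by field; nz.
  by rewrite -R3 mulfK.
rewrite S -[(-1) ^+ j]signr_odd.
case: (odd j); rewrite ?expr0 ?expr1; field; nz.
Qed.
End Transformations.

(** * Very-well-poised expansion of both factors of the summand *)

Section Expansion.
Variables (F : fieldType) (q : F).
Hypothesis q_neq0 : q != 0.
Local Notation qp x n := (qpoch x q n) (only parsing).
Implicit Types (b t : F).

(* [(b, t)] is [(q^-m, c)] for the sum over [j] and [(q^-l, -a)] for the sum
   over [i]; then [b t] is [ga], resp. [-al]. *)
Definition xfac b t k : F := qp t k * qp (- (b * t)) k / (qp q k * qp (b * t ^+ 2) k).

(** The coefficient independent of [k] in the expansion of [xfac b t k]. *)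
Definition xi b t j : F :=
  (1 - (b * t) ^+ 2 * q ^+ j * q ^+ j / q) * qp b j * (- t) ^+ j * q ^+ 'C(j, 2)
    * qpoch ((b * t) ^+ 2) (q ^+ 2) j
    / (qp q j * qp (b * t ^+ 2) j * qp ((b * t) ^+ 2 * q ^+ j / q) j.+1).

(** With [A = (b t)^2 / q], the length [2n + 1] covers [(A q^j)_(n+1)] for every [j <= n]. *)
Definition expandable b t n :=
  [&& qp (b * t) n != 0, qp (b * t ^+ 2) n != 0
    & qp ((b * t) ^+ 2 / q) (n + n).+1 != 0].

Lemma expandable_shift b t n j : expandable b t n -> (j <= n)%N ->
  qp ((b * t) ^+ 2 * q ^+ j / q) n.+1 != 0.
Proof.
case/and3P=> _ _ h le_jn; rewrite mulrAC.
by apply: qpoch_sub_neq0 h; rewrite addnS ltnS leq_add2r.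
Qed.

Lemma expandable_le b t m n : (m <= n)%N -> expandable b t n -> expandable b t m.
Proof.
move=> le_mn /and3P[h1 h2 h3]; apply/and3P; split.
- exact: qpoch_le_neq0 h1.
- exact: qpoch_le_neq0 h2.
by apply: qpoch_le_neq0 h3; rewrite ltnS leq_add.
Qed.

(** Multiply [vwp_sum] by [(b t)_k (- b t)_k = ((b t)^2; q^2)_k]. Splitting this factorial at [j],
    and [(A q^j)_(k+1)] at [j + 1], separates [xi] from an [efac] of length [k - j]. *)
Lemma xfac_expand b t k : qp q k != 0 -> expandable b t k ->
  xfac b t k
    = \sum_(0 <= j < k.+1) xi b t j * efac q ((b * t) ^+ 2 * q ^+ j.*2) (k - j).
Proof.
move=> qk bt; have [h1 h2 _] := and3P bt.
transitivity (qp (b * t) k * qp (- (b * t)) k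
    * (qp t k / (qp q k * qp (b * t ^+ 2) k * qp (b * t) k))).
  by rewrite /xfac; field; nz.
rewrite -vwp_sum //; last by move=> j; apply: expandable_shift.
rewrite qpoch_sqr mulr_sumr; apply: eq_big_nat => j /andP[_]; rewrite ltnS => le_jk.
have jrk : (j + (k - j))%N = k by rewrite subnKC.
have := expandable_shift bt le_jk; have qr := qpoch_le_neq0 (leq_subr j k) qk.
have qj := qpoch_le_neq0 le_jk qk; have bj := qpoch_le_neq0 le_jk h2.
rewrite /vwp_term /xi /efac -{1 2}jrk -addSn !(qpochD _ _ j) (qpochD _ _ j.+1) mulf_eq0 negb_or.
rewrite -[(q ^+ 2) ^+ j]exprM mul2n.
have -> : (b * t) ^+ 2 * q ^+ j / q * q ^+ j.+1 = (b * t) ^+ 2 * q ^+ j.*2.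
  by rewrite -addnn exprD (exprS q); field.
case/andP=> h3 h4; by field; nz.
Qed.

(** Expand the first factor over [j <= k] and the second over [i <= n - k], then move the sum over
    [r = k - j] inside. The sign splits as [(-1)^j (-1)^r], and the sum over [r] is [wsum] of length
    [n - i - j]. *)
Lemma sum_xfac b t b' t' n : qp q n != 0 -> expandable b t n -> expandable b' t' n ->
  \sum_(0 <= k < n.+1) (-1) ^+ k * xfac b t k * xfac b' t' (n - k)
  = \sum_(0 <= i < n.+1) \sum_(0 <= j < (n - i).+1) (-1) ^+ j * xi b t j * xi b' t' i
      * wsum q ((b * t) ^+ 2 * q ^+ j.*2) ((b' * t') ^+ 2 * q ^+ i.*2) (n - i - j).
Proof.
move=> qn bt bt'.
pose E j := efac q ((b * t) ^+ 2 * q ^+ j.*2); pose E' i := efac q ((b' * t') ^+ 2 * q ^+ i.*2).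
rewrite [RHS]sum_triangleC.
transitivity (\sum_(0 <= k < n.+1) \sum_(0 <= j < k.+1)
    (-1) ^+ (j + (k - j)) * xi b t j * E j (k - j)%N * xfac b' t' (n - j - (k - j))).
  apply: eq_big_nat => k /andP[_]; rewrite ltnS => le_kn.
  rewrite (xfac_expand (qpoch_le_neq0 le_kn qn) (expandable_le le_kn bt)) mulr_sumr mulr_suml.
  apply: eq_big_nat => j /andP[_]; rewrite ltnS => le_jk.
  by rewrite -subnDA subnKC // !mulrA.
rewrite (sum_triangle (fun j r => (-1) ^+ (j + r) * xi b t j * E j r * xfac b' t' (n - j - r))).
apply: eq_big_nat => j _.
transitivity (\sum_(0 <= r < (n - j).+1) \sum_(0 <= i < (n - j - r).+1)
    (-1) ^+ (j + r) * xi b t j * E j r * (xi b' t' i * E' i (n - j - r - i)%N)).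
  apply: eq_bigr => r _; have le_n : (n - j - r <= n)%N by rewrite -subnDA leq_subr.
  by rewrite (xfac_expand (qpoch_le_neq0 le_n qn) (expandable_le le_n bt')) mulr_sumr.
rewrite sum_triangleC; apply: eq_bigr => i _.
rewrite (subnAC n i j) /wsum mulr_sumr; apply: eq_bigr => r _.
by rewrite /wterm exprD (subnAC (n - j)%N i r) /E /E'; ring.
Qed.

End Expansion.

(** * Identification of [Tterm] with the terms of the expansion *)

Section Terms.
Variables (F : fieldType) (q : F).
Hypothesis q_neq0 : q != 0.
Local Notation qp x n := (qpoch x q n) (only parsing).

Lemma exprz_quot (z : int) (k1 k2 : nat) : z + k2%:Z = k1%:Z ->
  q ^ z = q ^+ k1 / q ^+ k2.
Proof.
move=> h; have -> : z = k1%:Z + - k2%:Z by rewrite -h addrK.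
by rewrite expfzDr // -exprnN.
Qed.

Lemma qpoch_double x p : qp x p.*2 = qpoch x (q ^+ 2) p * qpoch (q * x) (q ^+ 2) p.
Proof.
elim: p => [|p IHp]; first by rewrite !qpoch0 mulr1.
by rewrite doubleS !qpochS IHp -exprM mul2n (exprS q p.*2); ring.
Qed.

Variables (al ga : F) (l m : nat).
Hypotheses (al0 : al != 0) (ga0 : ga != 0) (two_neq0 : (2%:R : F) != 0).
Let a := al * q ^+ l.
Let c := ga * q ^+ m.

(** In terms of [al = a q^-l] and [ga = c q^-m] all integer powers of [q] become quotients of
    natural powers, a form that [field] handles. Since [n - i - j] is even, [chi] equals [2 / 2],
    which is 1 as 2 is nonzero. *)
Lemma Tterm_quot i j p (n := (i + j + p.*2)%N) :
  Tterm q a c l m n i j =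
    (-1) ^+ (i + j) * (q ^+ (n * i + p.*2 * j + 'C(j.+1, 2)) / q ^+ (p.*2 * m))
    * a ^+ i * c ^+ (j + p.*2)
    * ((1 - al ^+ 2 * q ^+ i * q ^+ i / q) / (1 - al ^+ 2 / q))
    * (qp ((q ^+ l)^-1) i * qp ((q ^+ n)^-1) i * qp (al ^+ 2 / q) i
        / (qp q i * qp (al ^+ 2 * q ^+ n) i * qp (al ^+ 2 * q ^+ l) i))
    * (qp ((q ^+ m)^-1) j * qp ((q ^+ (j + p.*2))^-1) j * qp (q / (q ^+ n * q ^+ i * al ^+ 2)) j
        * qp ga j * qp (- ga) j
        / (qp q j * qp (q / (q ^+ n * al)) j * qp (- (q / (q ^+ n * al))) j
           * qp (ga ^+ 2 * q ^+ m) j * qp (ga ^+ 2 * q ^+ j / q) j))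
    * (qpoch q (q ^+ 2) p * qpoch (q ^+ 2 / (q ^+ n * q ^+ n * al ^+ 2 * ga ^+ 2)) (q ^+ 2) p
        / (qpoch (q ^+ 2 * q ^+ j * q ^+ j / (q ^+ n * q ^+ n * al ^+ 2)) (q ^+ 2) p
           * qpoch (q * ga ^+ 2 * q ^+ j * q ^+ j) (q ^+ 2) p)).
Proof.
have qs k := expf_neq0 k q_neq0.
have nE : q ^+ n = q ^+ i * q ^+ j * q ^+ p * q ^+ p by rewrite /n -addnn !exprD !mulrA.
have z1 : q ^ (2 * i%:Z - 2 * l%:Z - 1) * a ^+ 2 = al ^+ 2 * q ^+ i * q ^+ i / q.
  rewrite (@exprz_quot _ (i + i) (l + l).+1); last by lia.
  by rewrite /a exprS !exprD; field; nz.
have z2 : q ^ (- 2 * l%:Z - 1) * a ^+ 2 = al ^+ 2 / q.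
  rewrite (@exprz_quot _ 0 (l + l).+1); last by lia.
  by rewrite /a expr0 exprS !exprD; field; nz.
have z3 k : q ^ (- k%:Z) = (q ^+ k)^-1 by rewrite -exprnN.
have z4 : q ^ (n%:Z - 2 * l%:Z) * a ^+ 2 = al ^+ 2 * q ^+ n.
  rewrite (@exprz_quot _ n (l + l)); last by lia.
  by rewrite /a !exprD; field; nz.
have z5 : q ^ (- l%:Z) * a ^+ 2 = al ^+ 2 * q ^+ l by rewrite z3 /a; field; nz.
have z6 : q ^ (i%:Z - n%:Z) = (q ^+ (j + p.*2))^-1.
  by rewrite -z3; congr (q ^ _); rewrite /n; lia.
have z7 : q ^ (1 + 2 * l%:Z - n%:Z - i%:Z) / a ^+ 2 = q / (q ^+ n * q ^+ i * al ^+ 2).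
  rewrite (@exprz_quot _ (l + l).+1 (n + i)); last by lia.
  by rewrite /a exprS !exprD; field; nz.
have z8 : q ^ (- m%:Z) * c = ga by rewrite z3 /c; field; nz.
have z8' : - q ^ (- m%:Z) * c = - ga by rewrite mulNr z8.
have z9 : q ^ (1 + l%:Z - n%:Z) / a = q / (q ^+ n * al).
  by rewrite (@exprz_quot _ l.+1 n); [rewrite /a exprS; field; nz | lia].
have z9' : - q ^ (1 + l%:Z - n%:Z) / a = - (q / (q ^+ n * al)) by rewrite mulNr z9.
have z10 : q ^ (- m%:Z) * c ^+ 2 = ga ^+ 2 * q ^+ m by rewrite z3 /c; field; nz.
have z11 : q ^ (j%:Z - 2 * m%:Z - 1) * c ^+ 2 = ga ^+ 2 * q ^+ j / q.
  rewrite (@exprz_quot _ j (m + m).+1); last by lia.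
  by rewrite /c exprS !exprD; field; nz.
have z12 : q ^ (2 + 2 * l%:Z + 2 * m%:Z - 2 * n%:Z) / (a ^+ 2 * c ^+ 2)
    = q ^+ 2 / (q ^+ n * q ^+ n * al ^+ 2 * ga ^+ 2).
  rewrite (@exprz_quot _ (l + l + (m + m)).+2 (n + n)); last by lia.
  by rewrite /a /c !(exprS q) !exprD; field; nz.
have z13 : q ^ (2 + 2 * l%:Z - 2 * n%:Z + 2 * j%:Z) / a ^+ 2
    = q ^+ 2 * q ^+ j * q ^+ j / (q ^+ n * q ^+ n * al ^+ 2).
  rewrite (@exprz_quot _ (l + l + (j + j)).+2 (n + n)); last by lia.
  by rewrite /a !(exprS q) !exprD; field; nz.
have z14 : q ^ (1 - 2 * m%:Z + 2 * j%:Z) * c ^+ 2 = q * ga ^+ 2 * q ^+ j * q ^+ j.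
  rewrite (@exprz_quot _ (j + j).+1 (m + m)); last by lia.
  by rewrite /c !(exprS q) !exprD; field; nz.
have z15 : q ^ (n%:Z * i%:Z + (n%:Z - i%:Z - j%:Z) * (j%:Z - m%:Z) + 'C(j.+1, 2)%:Z)
   = q ^+ (n * i + p.*2 * j + 'C(j.+1, 2)) / q ^+ (p.*2 * m).
  by apply: exprz_quot; move: 'C(j.+1, 2) => C; rewrite /n -!muln2 !(PoszD, PoszM); ring.
have le_ijn : (i + j <= n)%N := leq_addr _ _.
rewrite /Tterm le_ijn !qpochs_cons !qpochs_nil !mulr1.
have e1 : (n - i - j)%N = p.*2 by rewrite /n; lia.
have e2 : (n - i)%N = (j + p.*2)%N by rewrite /n; lia.
rewrite e1 e2 doubleK /chi -[(-1) ^+ p.*2]signr_odd odd_double expr0.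
have -> : (1 + 1) / 2 = 1 :> F by apply: mulfV.
rewrite mulr1 z15 z1 z2 z4 z5 z6 z7 z8 z8' z9 z9' z10 z11 z12 z13 z14 !z3.
by rewrite !mulrA.
Qed.

(** The power of [q] in [Tterm] is what the reversals [R1] to [R6] of [Tterm_xi] require: the
    denominator collects their monomials together with the sign and the power of [c] in [Tterm], the
    numerator those of the two [xi]. *)
Lemma Tterm_power i j p (n := (i + j + p.*2)%N) :
  q ^+ (n * i + p.*2 * j + 'C(j.+1, 2)) / q ^+ (p.*2 * m)
  = (-1) ^+ j * (- c) ^+ j * q ^+ 'C(j, 2) * q ^+ 'C(i, 2)
    / ((-1) ^+ (i + j) * c ^+ (j + p.*2)
       * ((-1) ^+ i / (q ^+ n) ^+ i * q ^+ 'C(i, 2))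
       * ((-1) ^+ j / (q ^+ (j + p.*2)) ^+ j * q ^+ 'C(j, 2))
       * ((-1) ^+ j * (q / (q ^+ n * q ^+ i * al ^+ 2)) ^+ j * q ^+ 'C(j, 2))
       / ((-1) ^+ j * (q / (q ^+ n * al)) ^+ j * q ^+ 'C(j, 2)
          * ((q / (q ^+ n * al)) ^+ j * q ^+ 'C(j, 2)))
       / (ga ^+ 2 * q ^+ j * q ^+ j) ^+ p).
Proof.
have qs k := expf_neq0 k q_neq0.
have E1 : q ^+ (n * i + p.*2 * j + 'C(j.+1, 2))
    = q ^+ (n * i) * (q ^+ (p * j) * q ^+ (p * j)) * (q ^+ 'C(j, 2) * q ^+ j).
  by rewrite binS bin1 -addnn mulnDl !exprD.
have E2 : (q ^+ (j + p.*2)) ^+ j = q ^+ 'C(j, 2) * q ^+ 'C(j, 2) * q ^+ j * (q ^+ (p * j) * q ^+ (p * j)).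
  by rewrite exp_bin2 -exprM -addnn !mulnDl !exprD.
have E3 : (q ^+ n) ^+ j = q ^+ (i * j) * ((q ^+ (j + p.*2)) ^+ j).
  by rewrite -!exprM -exprD -mulnDl addnA.
have E4 : c ^+ (j + p.*2) = c ^+ j * (ga ^+ p * ga ^+ p) * q ^+ (p.*2 * m).
  by rewrite exprD -mulrA; congr (_ * _); rewrite /c exprMn -exprM mulnC -addnn exprD.
have E5 : (ga ^+ 2 * q ^+ j * q ^+ j) ^+ p = (ga ^+ p * ga ^+ p) * (q ^+ (p * j) * q ^+ (p * j)).
  by rewrite !exprMn -!exprM (mulnC j) !mulrA.
have E6 : (q / (q ^+ n * q ^+ i * al ^+ 2)) ^+ j = q ^+ j / ((q ^+ n) ^+ j * q ^+ (i * j) * (al ^+ j * al ^+ j)).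
  by rewrite exprMn exprVn !exprMn -[(q ^+ i) ^+ j]exprM.
have E7 : (q / (q ^+ n * al)) ^+ j = q ^+ j / ((q ^+ n) ^+ j * al ^+ j).
  by rewrite exprMn exprVn !exprMn.
rewrite E1 E6 E7 E5 E4 E3 E2 -[(q ^+ n) ^+ i]exprM exprD [(- c) ^+ j]exprNn.
have alj := expf_neq0 j al0; have gap := expf_neq0 p ga0.
have cj : c ^+ j != 0 by rewrite expf_neq0 // /c mulf_neq0.
move: (qs (n * i)%N) (qs (p * j)%N) (qs 'C(j, 2)) (qs 'C(i, 2)) (qs j) (qs (i * j)%N) (qs (p.*2 * m)%N).
move: (q ^+ (n * i)) (q ^+ (p * j)) (q ^+ 'C(j, 2)) (q ^+ 'C(i, 2)) (q ^+ j) (q ^+ (i * j)) (q ^+ (p.*2 * m)).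
move: (c ^+ j) cj (al ^+ j) alj (ga ^+ p) gap => X1 x1 X2 x2 X3 x3 X4 X5 X6 X7 X8 X9 X10 x4 x5 x6 x7 x8 x9 x10.
rewrite -[(-1) ^+ i]signr_odd -[(-1) ^+ j]signr_odd.
by case: (odd i); case: (odd j); rewrite ?expr0 ?expr1; field; nz.
Qed.

(** By [wsum_even] the right side is a product. The factor [efac q (al ^+ 2) n] is common to all
    terms and is later absorbed by the prefactor. *)
Lemma Tterm_xi i j p (n := (i + j + p.*2)%N) :
  qp q n != 0 -> qp al n != 0 -> qp (- al) n != 0 -> qp (al ^+ 2 / q) (n + n).+1 != 0 ->
  qp (ga ^+ 2 / q) (n + n).+1 != 0 -> qp (ga ^+ 2 * al ^+ 2) (n + n) != 0 ->
  qp (al ^+ 2 * q ^+ l) i != 0 -> qp (ga ^+ 2 * q ^+ m) j != 0 ->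
  Tterm q a c l m n i j * efac q (al ^+ 2) n
    = (-1) ^+ j * xi q (q ^+ m)^-1 c j * xi q (q ^+ l)^-1 (- a) i
      * wsum q (ga ^+ 2 * q ^+ j.*2) (al ^+ 2 * q ^+ i.*2) p.*2.
Proof.
have N1 : (i.*2 + j.*2 + p.*2 <= n + n)%N by rewrite /n -!addnn; lia.
have N2 : (i.*2 + p.*2 <= n + n)%N by rewrite /n -!addnn; lia.
have N6 : (i.*2 + p.*2 + p.*2 <= n + n)%N by rewrite /n -!addnn; lia.
have N3 : (j.*2 + p.*2 <= n + n)%N by rewrite /n -!addnn; lia.
have N4 : (n + i = i + i + (p + p) + j)%N by rewrite /n -addnn; lia.
have N5 : (n + i <= n + n)%N by rewrite /n -addnn; lia.
move=> qn aln aln' al2n ga2n gh al2l ga2m.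
have qs k := expf_neq0 k q_neq0.
have nE : q ^+ n = q ^+ i * q ^+ j * q ^+ p * q ^+ p by rewrite /n -addnn !exprD !mulrA.
have le_pn : (p.*2 <= n)%N by rewrite /n leq_addl.
have al2s k r : (k + r <= n + n)%N -> qp (al ^+ 2 * q ^+ k) r != 0.
  move=> h; have -> : al ^+ 2 * q ^+ k = al ^+ 2 / q * q ^+ k.+1 by rewrite (exprS q k); field.
  by apply: qpoch_sub_neq0 al2n.
have ga2s k r : (k + r <= n + n)%N -> qp (ga ^+ 2 * q ^+ k) r != 0.
  move=> h; have -> : ga ^+ 2 * q ^+ k = ga ^+ 2 / q * q ^+ k.+1 by rewrite (exprS q k); field.
  by apply: qpoch_sub_neq0 ga2n.
have Ea : (q ^+ l)^-1 * - a = - al by rewrite /a; field; nz.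
have Ea2 : (q ^+ l)^-1 * (- a) ^+ 2 = al ^+ 2 * q ^+ l by rewrite /a; field; nz.
have Ec : (q ^+ m)^-1 * c = ga by rewrite /c; field; nz.
have Ec2 : (q ^+ m)^-1 * c ^+ 2 = ga ^+ 2 * q ^+ m by rewrite /c; field; nz.
rewrite wsum_even //; first last.
- rewrite mulrACA -exprD; apply: qpoch_sub_neq0 gh; by rewrite [(j.*2 + _)%N]addnC.
- exact: al2s N2.
- exact: ga2s N3.
- exact: qpoch_le_neq0 qn.
rewrite Tterm_quot -/n /xi Ea Ea2 Ec Ec2 sqrrN opprK /efac.
(* [R1] to [R6] reverse the factorials whose arguments contain [q^-n] or [q^-(j+2p)]. *)
have R1 : qp (q ^+ n)^-1 i = (-1) ^+ i / (q ^+ n) ^+ i * q ^+ 'C(i, 2) * qp q n / qp q (j + p.*2).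
  rewrite -[(_ ^+ i)^-1]exprVn -exprNn -(@qpoch_qVn _ _ q_neq0 _ _ (j + p.*2)%N) ?addnA // mulfK //.
  by apply: qpoch_le_neq0 qn; rewrite /n -addnA leq_addl.
have R2 : qp (q ^+ (j + p.*2))^-1 j = (-1) ^+ j / (q ^+ (j + p.*2)) ^+ j * q ^+ 'C(j, 2) * qp q (j + p.*2) / qp q p.*2.
  rewrite -[(_ ^+ j)^-1]exprVn -exprNn -(@qpoch_qVn _ _ q_neq0 _ _ p.*2) // mulfK //.
  exact: qpoch_le_neq0 qn.
have R3 : qp (q / (q ^+ n * q ^+ i * al ^+ 2)) j = (-1) ^+ j * (q / (q ^+ n * q ^+ i * al ^+ 2)) ^+ j
    * q ^+ 'C(j, 2) * qp (al ^+ 2 * q ^+ (i + i + p.*2)) j.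
  rewrite -exprNn; apply: qpoch_rev => //.
  by rewrite nE -addnn !exprD; field; nz.
have R4 : qp (q / (q ^+ n * al)) j = (-1) ^+ j * (q / (q ^+ n * al)) ^+ j
    * q ^+ 'C(j, 2) * qp (al * q ^+ (i + p.*2)) j.
  rewrite -exprNn; apply: qpoch_rev => //.
  by rewrite nE -addnn !exprD; field; nz.
have R5 : qp (- (q / (q ^+ n * al))) j = (q / (q ^+ n * al)) ^+ j
    * q ^+ 'C(j, 2) * qp (- (al * q ^+ (i + p.*2))) j.
  rewrite -[X in X ^+ j]opprK; apply: qpoch_rev => //.
  by rewrite nE -addnn !exprD; field; nz.
have q2_neq0 : q ^+ 2 != 0 by [].
have R6 : qpoch (q ^+ 2 / (q ^+ n * q ^+ n * al ^+ 2 * ga ^+ 2)) (q ^+ 2) p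
    * qpoch (al ^+ 2 * q ^+ i.*2 * q ^+ p.*2) (q ^+ 2) p
  = qpoch (q ^+ 2 * q ^+ j * q ^+ j / (q ^+ n * q ^+ n * al ^+ 2)) (q ^+ 2) p
    * qpoch (ga ^+ 2 * q ^+ j.*2 * (al ^+ 2 * q ^+ i.*2) * q ^+ p.*2) (q ^+ 2) p
    / (ga ^+ 2 * q ^+ j * q ^+ j) ^+ p.
  set y1 := q ^+ 2 / _; set y2 := q ^+ 2 * _ * _ / _.
  have y1y2 : y2 = y1 * (ga ^+ 2 * q ^+ j * q ^+ j) by rewrite /y1 /y2; field; nz.
  have y10 : y1 ^+ p != 0 by rewrite expf_neq0 // /y1 !mulf_neq0 // invr_neq0 // !mulf_neq0.
  have G0 : (ga ^+ 2 * q ^+ j * q ^+ j) ^+ p != 0 by rewrite expf_neq0 // !mulf_neq0.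
  apply: (mulIf G0); rewrite mulfVK //; apply: (mulIf y10).
  rewrite -mulrA -exprMn [_ * y1]mulrC -y1y2; apply: qpoch_rev2 => //.
    by rewrite /y1 nE -!exprM !mul2n -!addnn !exprD; field; nz.
  by rewrite /y2 nE -!exprM !mul2n -!addnn !exprD; field; nz.
(* [P1] to [P6] cut the remaining factorials into blocks shared by both sides, passing between the
   bases [q] and [q^2]. *)
have P1 : qpoch (al ^+ 2) (q ^+ 2) n = qpoch (al ^+ 2) (q ^+ 2) i
    * qpoch (al ^+ 2 * q ^+ i.*2) (q ^+ 2) p * qpoch (al ^+ 2 * q ^+ i.*2 * q ^+ p.*2) (q ^+ 2) p
    * (qp (al * q ^+ (i + p.*2)) j * qp (- (al * q ^+ (i + p.*2))) j).
  rewrite qpoch_sqr /n addnAC -addnn addnA !(qpochD _ (q ^+ 2)) -!exprM; congr (_ * _ * _ * _).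
  - by rewrite mul2n.
  - by rewrite mul2n doubleD exprD mulrA -!addnn.
  by rewrite exprMn -exprM mulnC -addnA addnn.
have P2 : qp (al ^+ 2) n * qp (al ^+ 2 * q ^+ n) i = qp (al ^+ 2) i.*2
    * (qpoch (al ^+ 2 * q ^+ i.*2) (q ^+ 2) p * qpoch (q * (al ^+ 2 * q ^+ i.*2)) (q ^+ 2) p)
    * qp (al ^+ 2 * q ^+ (i + i + p.*2)) j.
  by rewrite -qpochD -qpoch_double -qpochD -!addnn -qpochD N4.
have P3 : (1 - al ^+ 2 / q) * qp (al ^+ 2) i.*2 = qp (al ^+ 2 / q) i * qp (al ^+ 2 * q ^+ i / q) i.+1.
  by rewrite -[al ^+ 2 * q ^+ i / q]mulrAC -qpochD addnS qpochSl addnn mulfVK.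
have P4 : qp q p.*2 = qpoch q (q ^+ 2) p * qpoch (q ^+ 2) (q ^+ 2) p by rewrite qpoch_double -expr2.
have P5 : qp ga j * qp (- ga) j = qpoch (ga ^+ 2) (q ^+ 2) j by rewrite qpoch_sqr.
have P6 : qp (ga ^+ 2 * q ^+ j / q) j.+1 = qp (ga ^+ 2 * q ^+ j / q) j * (1 - ga ^+ 2 * q ^+ j * q ^+ j / q).
  by rewrite qpochS; congr (_ * (1 - _)); ring.
have le_in : (i <= n)%N := leq_trans (leq_addr j i) (leq_addr p.*2 _).
have le_jn : (j <= n)%N := leq_trans (leq_addl i j) (leq_addr p.*2 _).
have qi := qpoch_le_neq0 le_in qn; have qj := qpoch_le_neq0 le_jn qn.
have qjp : qp q (j + p.*2) != 0.
  by apply: qpoch_le_neq0 qn; rewrite /n -addnA leq_addl.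
have := qpoch_le_neq0 le_pn qn; rewrite P4 mulf_eq0 negb_or => /andP[q1 q2].
have u1 : qp (al * q ^+ (i + p.*2)) j != 0.
  by apply: qpoch_sub_neq0 aln; rewrite addnAC.
have u2 : qp (- (al * q ^+ (i + p.*2))) j != 0.
  by rewrite -mulNr; apply: qpoch_sub_neq0 aln'; rewrite addnAC.
have h2 : qpoch (al ^+ 2 * q ^+ i.*2 * q ^+ p.*2) (q ^+ 2) p != 0.
  have := al2s (i.*2 + p.*2)%N p.*2 N6; rewrite exprD mulrA qpoch_double mulf_eq0.
  by case/norP.
have := al2s _ _ N2; rewrite qpoch_double mulf_eq0 negb_or => /andP[h1 h3].
have := ga2s _ _ N3; rewrite qpoch_double mulf_eq0 negb_or => /andP[_ g1].
have w : qp (al ^+ 2 * q ^+ (i + i + p.*2)) j != 0 by apply: al2s; rewrite -addnn -N4.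
have X := al2s _ _ N5.
have Y : qpoch (q ^+ 2 * q ^+ j * q ^+ j / (q ^+ n * q ^+ n * al ^+ 2)) (q ^+ 2) p != 0.
  have e : al ^+ 2 * q ^+ i.*2 * q ^+ p.*2 * (q ^+ 2 * q ^+ j * q ^+ j / (q ^+ n * q ^+ n * al ^+ 2)) * (q ^+ 2) ^+ p = q ^+ 2.
    by rewrite nE -!exprM !mul2n -!addnn !exprD; field; nz.
  rewrite (qpoch_rev q2_neq0 e) !mulf_neq0 // expf_neq0 // ?oppr_eq0 //.
  by rewrite !mulf_neq0 // invr_neq0 // !mulf_neq0.
have : qp (al ^+ 2 / q) i.*2.+1 != 0 by apply: qpoch_le_neq0 al2n; rewrite ltnS -addnn (leq_add le_in le_in).
rewrite qpochSl mulfVK // mulf_eq0 negb_or => /andP[s0 D0].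
have : (1 - al ^+ 2 / q) * qp (al ^+ 2) i.*2 != 0 by rewrite mulf_neq0.
rewrite P3 mulf_eq0 negb_or => /andP[s1 s2].
have : qp (ga ^+ 2 * q ^+ j / q) j.+1 != 0.
  by rewrite mulrAC; apply: qpoch_sub_neq0 ga2n; rewrite addnS ltnS (leq_add le_jn le_jn).
rewrite P6 mulf_eq0 negb_or => /andP[g2 g3].
have al2n' := al2s 0%N n (leq_addl _ _).
have P2' : qp (al ^+ 2) n = qp (al ^+ 2) i.*2
    * (qpoch (al ^+ 2 * q ^+ i.*2) (q ^+ 2) p * qpoch (q * (al ^+ 2 * q ^+ i.*2)) (q ^+ 2) p)
    * qp (al ^+ 2 * q ^+ (i + i + p.*2)) j / qp (al ^+ 2 * q ^+ n) i by rewrite -P2 mulfK.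
have P3' : 1 - al ^+ 2 / q = qp (al ^+ 2 / q) i * qp (al ^+ 2 * q ^+ i / q) i.+1 / qp (al ^+ 2) i.*2.
  by rewrite -P3 mulfK.
have R6' : qpoch (q ^+ 2 / (q ^+ n * q ^+ n * al ^+ 2 * ga ^+ 2)) (q ^+ 2) p
  = qpoch (q ^+ 2 * q ^+ j * q ^+ j / (q ^+ n * q ^+ n * al ^+ 2)) (q ^+ 2) p
    * qpoch (ga ^+ 2 * q ^+ j.*2 * (al ^+ 2 * q ^+ i.*2) * q ^+ p.*2) (q ^+ 2) p
    / (ga ^+ 2 * q ^+ j * q ^+ j) ^+ p / qpoch (al ^+ 2 * q ^+ i.*2 * q ^+ p.*2) (q ^+ 2) p.
  by rewrite -R6 mulfK.
have gE : q * (ga ^+ 2 * q ^+ j.*2) = q * ga ^+ 2 * q ^+ j * q ^+ j by rewrite -addnn exprD !mulrA.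
rewrite gE in g1 *.
rewrite Tterm_power -/n R1 R2 R3 R4 R5 R6' P1 P2' P3' P4 -P5.
have sg k : (-1) ^+ k != 0 :> F by rewrite signr_eq0.
have c0 : c != 0 by rewrite /c mulf_neq0.
have y1 : (q / (q ^+ n * q ^+ i * al ^+ 2)) ^+ j != 0.
  by rewrite expf_neq0 // mulf_neq0 // invr_neq0 // !mulf_neq0.
have y2 : (q / (q ^+ n * al)) ^+ j != 0.
  by rewrite expf_neq0 // mulf_neq0 // invr_neq0 // !mulf_neq0.
have y3 : (ga ^+ 2 * q ^+ j * q ^+ j) ^+ p != 0 by rewrite expf_neq0 // !mulf_neq0.
(* Each factorial and power is now generalized to a variable: what remains is an identity of
   monomials in independent quantities. *)
move: (sg (i + j)%N) (sg i) (sg j) (qs 'C(j, 2)) (qs 'C(i, 2)) (expf_neq0 (j + p.*2) c0).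
move: (expf_neq0 i (qs n)) (expf_neq0 j (qs (j + p.*2)%N)) y1 y2 y3.
move: s1 s2 D0 qn qjp qi X al2l q1 q2 w qj u1 u2 ga2m g2 g3 Y h2 g1 h1 h3.
move: (qp (al ^+ 2 / q) i) (qp (al ^+ 2 * q ^+ i / q) i.+1) (qp (al ^+ 2) i.*2) (qp q n)
  (qp q (j + p.*2)) (qp q i) (qp (al ^+ 2 * q ^+ n) i) (qp (al ^+ 2 * q ^+ l) i)
  (qpoch q (q ^+ 2) p) (qpoch (q ^+ 2) (q ^+ 2) p) (qp (al ^+ 2 * q ^+ (i + i + p.*2)) j)
  (qp q j) (qp (al * q ^+ (i + p.*2)) j) (qp (- (al * q ^+ (i + p.*2))) j)
  (qp (ga ^+ 2 * q ^+ m) j) (qp (ga ^+ 2 * q ^+ j / q) j) (1 - ga ^+ 2 * q ^+ j * q ^+ j / q)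
  (qpoch (q ^+ 2 * q ^+ j * q ^+ j / (q ^+ n * q ^+ n * al ^+ 2)) (q ^+ 2) p)
  (qpoch (al ^+ 2 * q ^+ i.*2 * q ^+ p.*2) (q ^+ 2) p)
  (qpoch (q * ga ^+ 2 * q ^+ j * q ^+ j) (q ^+ 2) p)
  (qpoch (al ^+ 2 * q ^+ i.*2) (q ^+ 2) p) (qpoch (q * (al ^+ 2 * q ^+ i.*2)) (q ^+ 2) p).
move=> X1 X2 X3 X4 X5 X6 X7 X8 X9 X10 X11 X12 X13 X14 X15 X16 X17 X18 X19 X20 X21 X22.
move=> x1 x2 x3 x4 x5 x6 x7 x8 x9 x10 x11 x12 x13 x14 x15 x16 x17 x18 x19 x20 x21 x22.
move: ((q ^+ n) ^+ i) ((q ^+ (j + p.*2)) ^+ j) ((q / (q ^+ n * q ^+ i * al ^+ 2)) ^+ j : F)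
  ((q / (q ^+ n * al)) ^+ j : F) ((ga ^+ 2 * q ^+ j * q ^+ j) ^+ p) ((-1) ^+ (i + j) : F)
  ((-1) ^+ i : F) ((-1) ^+ j : F) (q ^+ 'C(j, 2)) (q ^+ 'C(i, 2)) (c ^+ (j + p.*2)).
move=> Y1 Y2 Y3 Y4 Y5 Y6 Y7 Y8 Y9 Y10 Y11 z1 z2 z3 z4 z5 z6 z7 z8 z9 z10 z11.
move: ((- c) ^+ j : F) (a ^+ i) (1 - al ^+ 2 * q ^+ i * q ^+ i / q) (qp (q ^+ l)^-1 i)
  (qp (q ^+ m)^-1 j) (qp ga j) (qp (- ga) j) (qpoch (al ^+ 2) (q ^+ 2) i)
  (qpoch (ga ^+ 2 * q ^+ j.*2 * (al ^+ 2 * q ^+ i.*2) * q ^+ p.*2) (q ^+ 2) p).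
move=> Z1 Z2 Z3 Z4 Z5 Z6 Z7 Z8 Z9.
by field; nz.
Qed.

End Terms.

(** * Integer powers of [q] and index bounds *)

Section Exponents.
Variables (F : fieldType) (q : F).
Hypothesis q_neq0 : q != 0.

Lemma exprz_succB (l n : nat) : q ^ (1 + l%:Z - n%:Z) = q * q ^+ l / q ^+ n.
Proof. by rewrite (@exprz_quot _ _ q_neq0 _ l.+1 n) ?exprS //; lia. Qed.

Lemma exprz_succDB (l m n : nat) :
  q ^ (1 + l%:Z + m%:Z - n%:Z) = q * q ^+ l * q ^+ m / q ^+ n.
Proof.
by rewrite (@exprz_quot _ _ q_neq0 _ (l + m).+1 n) ?exprS ?exprD ?mulrA //; lia.
Qed.

End Exponents.

Lemma index_bounds (i j N n : nat) : n = (i + j + N)%N ->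
  [/\ (i.*2 + N <= n + n)%N, (j.*2 + N <= n + n)%N & (j.*2 + i.*2 + N <= n + n)%N].
Proof. by move=> ->; split; rewrite -!addnn; lia. Qed.

(** * The identity for generic parameters *)

Section GenericIdentity.
Variables (F : fieldType) (q : F).
Hypothesis q_neq0 : q != 0.
Local Notation qp x n := (qpoch x q n) (only parsing).
Variables (al ga : F) (l m n : nat).
Hypotheses (al0 : al != 0) (ga0 : ga != 0) (two_neq0 : (2%:R : F) != 0).
Let a := al * q ^+ l.
Let c := ga * q ^+ m.

(** Together with [(q)_n != 0] these conditions justify all divisions in the generic case; for
    instance [(-al)_(n+l)] covers [(-al)_n] and [(-a)_n]. Under the scaling [al t], [ga t^2] each
    argument is a constant times a positive power of [t], so each condition fails for finitely many
    [t] only. *)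
Definition generic_params :=
  [&& qp al n != 0, qp (- al) (n + l) != 0, qp (al ^+ 2 / q) (n + n + l).+1 != 0,
      qp ga n != 0, qp (ga ^+ 2 / q) (n + n + m).+1 != 0,
      qp (ga ^+ 2 * al ^+ 2) (n + n) != 0 & qp (- (a * c)) n != 0].

Hypotheses (qn : qp q n != 0) (gen : generic_params).

Let qs k : q ^+ k != 0. Proof. exact: expf_neq0. Qed.
Let a0 : a != 0. Proof. exact: mulf_neq0. Qed.
Let c0 : c != 0. Proof. exact: mulf_neq0. Qed.

Lemma generic_al2 k r : (k + r <= n + n + l)%N -> qp (al ^+ 2 * q ^+ k) r != 0.
Proof.
case/and5P: gen => _ _ h _ _ kr.
have -> : al ^+ 2 * q ^+ k = al ^+ 2 / q * q ^+ k.+1 by rewrite (exprS q k); field.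
exact: qpoch_sub_neq0 h.
Qed.

Lemma generic_ga2 k r : (k + r <= n + n + m)%N -> qp (ga ^+ 2 * q ^+ k) r != 0.
Proof.
case/and5P: gen => _ _ _ _ /and3P[h _ _] kr.
have -> : ga ^+ 2 * q ^+ k = ga ^+ 2 / q * q ^+ k.+1 by rewrite (exprS q k); field.
exact: qpoch_sub_neq0 h.
Qed.

Lemma generic_ma : qp (- a) n != 0.
Proof.
case/and5P: gen => _ h _ _ _; rewrite /a -mulNr.
by apply: qpoch_sub_neq0 h; rewrite addnC.
Qed.

Lemma generic_mal : qp (- al) n != 0.
Proof. by case/and5P: gen => _ h _ _ _; apply: qpoch_le_neq0 h; rewrite leq_addr. Qed.

(** Sears' transformation with [c] as the distinguished upper parameter and [p = - a / ga]; the
    lower parameter [q^(1+l-n) / a] is kept. *)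
Lemma phi43_generic :
  phi43 n (q ^ (- n%:Z)) a c (- q ^ (1 + l%:Z + m%:Z - n%:Z) / (a * c))
    (q ^ (1 + l%:Z - n%:Z) / a) (q ^ (1 + m%:Z - n%:Z) / c) (- (a * c)) q q
  = (qp (- a) n * qp (ga ^+ 2 * q ^+ m) n / (qp (- (a * c)) n * qp ga n))
    * \sum_(0 <= k < n.+1) qp (q ^+ n)^-1 k * qp c k * qp (q / (q ^+ n * (al ^+ 2 * q ^+ l))) k
        * qp (- ga) k * q ^+ k
        / (qp q k * qp (q / (q ^+ n * al)) k * qp (ga ^+ 2 * q ^+ m) k
           * qp (- (q / (q ^+ n * a))) k).
Proof.
have gan : qp ga n != 0 by case/and5P: gen => _ _ _ + _.
have acn : qp (- (a * c)) n != 0 by case/and5P: gen => _ _ _ _ /and3P[_ _].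
have aln : qp al n != 0 by case/and5P: gen.
have ga2 : qp (ga ^+ 2 * q ^+ m) n != 0 by apply: generic_ga2; rewrite addnC leq_add2r leq_addr.
(* Chosen so that [c u] is the lower parameter [q^(1+m-n) / c]; the transformed series then has
   [q^(1-n) / u = ga^2 q^m]. *)
pose u := q / (q ^+ n * (ga ^+ 2 * q ^+ m)).
have u0 : u != 0 by rewrite /u mulf_neq0 // invr_neq0 // !mulf_neq0.
have cu : c * u = q / (q ^+ n * ga) by rewrite /u /c; field; nz.
have rv z w : z * w * q ^+ n = q -> w != 0 -> qp z n != 0 -> qp w n != 0.
  move=> e w0 zn; rewrite (qpoch_rev q_neq0 e) !mulf_neq0 // expf_neq0 // oppr_eq0 //.
have nq z : z != 0 -> q / (q ^+ n * z) != 0.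
  by move=> z0; rewrite mulf_neq0 // invr_neq0 // mulf_neq0.
have := @sears F q q_neq0 c (q / (q ^+ n * (al ^+ 2 * q ^+ l))) (- ga) u (- a) n c0 u0.
have pE : c * u * (- a) * q ^+ n / q = - (a / ga) by rewrite cu; field; nz.
have pxy : - (a / ga) * (q / (q ^+ n * (al ^+ 2 * q ^+ l))) * (- ga) = q / (q ^+ n * al).
  by rewrite /a; field; nz.
have px : - (a / ga) * (q / (q ^+ n * (al ^+ 2 * q ^+ l))) = - q ^ (1 + l%:Z + m%:Z - n%:Z) / (a * c).
  by rewrite exprz_succDB // /a /c; field; nz.
have py : - (a / ga) * (- ga) = a by field; nz.
have qu : q / (q ^+ n * u) = ga ^+ 2 * q ^+ m by rewrite /u; field; nz.
have qv : q / (q ^+ n * - a) = - (q / (q ^+ n * a)) by field; nz.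
have d1 : q ^ (1 + l%:Z - n%:Z) / a = q / (q ^+ n * al).
  by rewrite exprz_succB // /a; field; nz.
have d2 : q ^ (1 + m%:Z - n%:Z) / c = q / (q ^+ n * ga).
  by rewrite exprz_succB // /c; field; nz.
cbv zeta; rewrite pE pxy px py qu qv cu mulrN [c * a]mulrC => S.
rewrite /phi43 d1 d2 -exprnN.
rewrite (eq_bigr (fun k => qp (q ^+ n)^-1 k * qp c k * qp a k
   * qp (- q ^ (1 + l%:Z + m%:Z - n%:Z) / (a * c)) k * q ^+ k
   / (qp q k * qp (q / (q ^+ n * al)) k * qp (q / (q ^+ n * ga)) k * qp (- (a * c)) k))); last first.
  by move=> k _; rewrite !qpochs_cons !qpochs_nil !mulr1 !invfM; ring.
rewrite S //; first last.
- by apply: (rv al) aln => //; [field; nz | exact: nq].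
- apply: (rv (- a)); [by field; nz | by rewrite oppr_eq0 nq | exact: generic_ma].
- by apply: (rv ga) gan => //; [field; nz | exact: nq].
- by rewrite oppr_eq0.
have R : qp u n * qp ga n * (c * u) ^+ n = qp (c * u) n * qp (ga ^+ 2 * q ^+ m) n * u ^+ n.
  by apply: qpoch_rev2; rewrite ?cu /u //; field; nz.
have cun : qp (c * u) n != 0 by rewrite cu; apply: (rv ga) gan => //; [field; nz | exact: nq].
have R' : qp u n * c ^+ n = qp (c * u) n * qp (ga ^+ 2 * q ^+ m) n / qp ga n.
  apply: (mulIf (expf_neq0 n u0)); rewrite -[LHS]mulrA -exprMn; apply: (mulIf gan).
  by rewrite mulrAC R; field; nz.
rewrite [c ^+ n * _]mulrC R' -cu; congr (_ * _).
by field; nz.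
Qed.

(** Reversing the four factorials with [q^-n] in their arguments replaces each by a quotient of
    factorials of lengths [n] and [n - k], so the series becomes an alternating convolution of two
    [xfac]. *)
Lemma phi_sum_generic :
  \sum_(0 <= k < n.+1) qp (q ^+ n)^-1 k * qp c k * qp (q / (q ^+ n * (al ^+ 2 * q ^+ l))) k
        * qp (- ga) k * q ^+ k
        / (qp q k * qp (q / (q ^+ n * al)) k * qp (ga ^+ 2 * q ^+ m) k
           * qp (- (q / (q ^+ n * a))) k)
  = qp (al ^+ 2 * q ^+ l) n * qp q n / (qp al n * qp (- a) n)
    * \sum_(0 <= k < n.+1) (-1) ^+ k * xfac q (q ^+ m)^-1 c k * xfac q (q ^+ l)^-1 (- a) (n - k).
Proof.
rewrite mulr_sumr; apply: eq_big_nat => k /andP[_]; rewrite ltnS => le_kn.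
set r := (n - k)%N; have krn : (k + r)%N = n by rewrite subnKC.
have le_rn : (r <= n)%N by rewrite leq_subr.
have Ea : (q ^+ l)^-1 * - a = - al by rewrite /a; field; nz.
have Ea2 : (q ^+ l)^-1 * (- a) ^+ 2 = al ^+ 2 * q ^+ l by rewrite /a; field; nz.
have Ec : (q ^+ m)^-1 * c = ga by rewrite /c; field; nz.
have Ec2 : (q ^+ m)^-1 * c ^+ 2 = ga ^+ 2 * q ^+ m by rewrite /c; field; nz.
rewrite /xfac Ea Ea2 Ec Ec2 opprK.
have aln : qp al n != 0 by case/and5P: gen.
have an := generic_ma.
have al2 : qp (al ^+ 2 * q ^+ l) n != 0.
  by apply: generic_al2; rewrite addnC leq_add2r leq_addr.
have ga2 : qp (ga ^+ 2 * q ^+ m) k != 0.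
  by apply: (qpoch_le_neq0 le_kn); apply: generic_ga2; rewrite addnC leq_add2r leq_addr.
have qk := qpoch_le_neq0 le_kn qn; have qr := qpoch_le_neq0 le_rn qn.
have E z : qp z n = qp z r * qp (z * q ^+ r) k by rewrite -qpochD addnC krn.
have nE : q ^+ n = q ^+ k * q ^+ r by rewrite -exprD krn.
have R1 : qp (q ^+ n)^-1 k = (-1) ^+ k / (q ^+ n) ^+ k * q ^+ 'C(k, 2) * qp q n / qp q r.
  by rewrite -[(_ ^+ k)^-1]exprVn -exprNn -(qpoch_qVn q_neq0 krn) mulfK.
have R2 : qp (q / (q ^+ n * (al ^+ 2 * q ^+ l))) k = (-1) ^+ k * (q / (q ^+ n * (al ^+ 2 * q ^+ l))) ^+ k
    * q ^+ 'C(k, 2) * qp (al ^+ 2 * q ^+ l * q ^+ r) k.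
  by rewrite -exprNn; apply: qpoch_rev => //; rewrite nE; field; nz.
have R3 : qp (q / (q ^+ n * al)) k = (-1) ^+ k * (q / (q ^+ n * al)) ^+ k
    * q ^+ 'C(k, 2) * qp (al * q ^+ r) k.
  by rewrite -exprNn; apply: qpoch_rev => //; rewrite nE; field; nz.
have R4 : qp (- (q / (q ^+ n * a))) k = (q / (q ^+ n * a)) ^+ k
    * q ^+ 'C(k, 2) * qp (- a * q ^+ r) k.
  by rewrite -[X in X ^+ k]opprK; apply: qpoch_rev => //; rewrite nE; field; nz.
(* The powers from the reversals cancel against [q^k]; only the sign [(-1)^k] is left. *)
have S : (q / (q ^+ n * (al ^+ 2 * q ^+ l))) ^+ k * q ^+ k
   = (q / (q ^+ n * al)) ^+ k * (q / (q ^+ n * a)) ^+ k * (q ^+ n) ^+ k.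
  by rewrite -!exprMn; congr (_ ^+ _); rewrite /a; field; nz.
move: aln an al2; rewrite (E al) (E (- a)) (E (al ^+ 2 * q ^+ l)) !mulf_eq0 !negb_or => /andP[h1 h2] /andP[h3 h4] /andP[h5 h6].
have S' : q ^+ k = (q / (q ^+ n * al)) ^+ k * (q / (q ^+ n * a)) ^+ k * (q ^+ n) ^+ k
    / (q / (q ^+ n * (al ^+ 2 * q ^+ l))) ^+ k.
  rewrite -S mulrC mulKf // expf_neq0 // mulf_neq0 // invr_neq0 // !mulf_neq0 //.
rewrite R1 R2 R3 R4 S'.
have y1 : (q / (q ^+ n * (al ^+ 2 * q ^+ l))) ^+ k != 0.
  by rewrite expf_neq0 // mulf_neq0 // invr_neq0 // !mulf_neq0.
have y2 : (q / (q ^+ n * al)) ^+ k != 0.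
  by rewrite expf_neq0 // mulf_neq0 // invr_neq0 // !mulf_neq0.
have y3 : (q / (q ^+ n * a)) ^+ k != 0.
  by rewrite expf_neq0 // mulf_neq0 // invr_neq0 // !mulf_neq0.
move: y1 y2 y3 (expf_neq0 k (qs n)).
move: ((q / (q ^+ n * (al ^+ 2 * q ^+ l))) ^+ k : F) ((q / (q ^+ n * al)) ^+ k : F)
  ((q / (q ^+ n * a)) ^+ k : F) ((q ^+ n) ^+ k) => Y1 Y2 Y3 Y4 y1 y2 y3 y4.
move: (negbT (signr_eq0 F k)) (qs 'C(k, 2)); move: ((-1) ^+ k : F) (q ^+ 'C(k, 2)) => Y5 Y6 y5 y6.
by field; nz.
Qed.

(** The ranges differ but the nonzero terms agree: [(q^-l)_i] and [(q^-m)_j] inside [xi] vanish for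
    [i > l] and [j > m], and [Tterm] is 0 for [i + j > n]. For odd [n - i - j] both sides vanish, by
    [chi] and by [wsum_odd]. *)
Lemma sum_Tterm :
  (\sum_(0 <= i < l.+1) \sum_(0 <= j < m.+1) Tterm q a c l m n i j) * efac q (al ^+ 2) n
  = \sum_(0 <= i < n.+1) \sum_(0 <= j < (n - i).+1)
      (-1) ^+ j * xi q (q ^+ m)^-1 c j * xi q (q ^+ l)^-1 (- a) i
      * wsum q (ga ^+ 2 * q ^+ j.*2) (al ^+ 2 * q ^+ i.*2) (n - i - j).
Proof.
pose H i j := (-1) ^+ j * xi q (q ^+ m)^-1 c j * xi q (q ^+ l)^-1 (- a) i
      * wsum q (ga ^+ 2 * q ^+ j.*2) (al ^+ 2 * q ^+ i.*2) (n - i - j).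
have xi0 s t k : (s < k)%N -> xi q (q ^+ s)^-1 t k = 0.
  move=> lt_sk; rewrite /xi (_ : qp (q ^+ s)^-1 k = 0) ?(mulr0, mul0r) //.
  by rewrite -(subnKC lt_sk) qpochD qpochS mulVf // subrr mulr0 mul0r.
have TH i j : (i <= l)%N -> (j <= m)%N -> (i + j <= n)%N ->
    Tterm q a c l m n i j * efac q (al ^+ 2) n = H i j.
  move=> le_il le_jm le_ijn.
  rewrite /H; set N := (n - i - j)%N.
  have [p Np] : exists p, N = (odd N + p.*2)%N by exists N./2; rewrite odd_double_half.
  have nE : n = (i + j + N)%N by rewrite /N -subnDA subnKC.
  have le_in : (i <= n)%N by rewrite nE -addnA leq_addr.
  have le_jn : (j <= n)%N by rewrite nE addnAC leq_addl.
  have le_Nn : (N <= n)%N by rewrite nE leq_addl.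
  case/and5P: gen => g1 g2 g3 g4 /and3P[g5 g6 g7].
  have [b1 b2 ij] := index_bounds nE.
  have al2i : qp (al ^+ 2 * q ^+ i.*2) N != 0.
    by apply: generic_al2; apply: leq_trans b1 (leq_addr _ _).
  have ga2j : qp (ga ^+ 2 * q ^+ j.*2) N != 0.
    by apply: generic_ga2; apply: leq_trans b2 (leq_addr _ _).
  have gh : qp (ga ^+ 2 * q ^+ j.*2 * (al ^+ 2 * q ^+ i.*2)) N != 0.
    by rewrite mulrACA -exprD; apply: qpoch_sub_neq0 g6.
  have qN := qpoch_le_neq0 le_Nn qn.
  case: (odd N) Np => Np; rewrite ?add0n ?add1n in Np.
    have -> : Tterm q a c l m n i j = 0.
      rewrite /Tterm le_ijn -/N Np /chi -[(-1) ^+ p.*2.+1]signr_odd /= odd_double expr1.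
      by rewrite subrr mul0r mulr0.
    by rewrite Np wsum_odd -?Np // ?mulr0 ?mul0r.
  rewrite Np in nE *; rewrite {1 2}nE.
  rewrite -Tterm_xi; rewrite -?nE //.
  - exact: generic_mal.
  - by apply: qpoch_le_neq0 g3; rewrite ltnS leq_addr.
  - by apply: qpoch_le_neq0 g5; rewrite ltnS leq_addr.
  - by apply: generic_al2; rewrite addnC leq_add2r; rewrite (leq_trans le_in) // leq_addr.
  by apply: generic_ga2; rewrite addnC leq_add2r; rewrite (leq_trans le_jn) // leq_addr.
(* The guard is needed because [n - i - j] is a truncated difference in [H]. Both double sums are
   compared with the sum of [G] over a square containing their ranges. *)
pose G i j := if (i + j <= n)%N then H i j else 0.
have Gl i j : (l < i)%N -> G i j = 0.
  by move=> lt_li; rewrite /G; case: ifP => // _; rewrite /H [xi _ _ (- a) _]xi0 // mulr0 mul0r.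
have Gm i j : (m < j)%N -> G i j = 0.
  by move=> lt_mj; rewrite /G; case: ifP => // _; rewrite /H xi0 // mulr0 !mul0r.
have Gn i j : (n < i + j)%N -> G i j = 0 by move=> h; rewrite /G leqNgt h.
pose N := (l + m + n).+1.
transitivity (\sum_(0 <= i < N) \sum_(0 <= j < N) G i j).
  rewrite (@sum_nat_trunc _ (fun i => \sum_(0 <= j < N) G i j) l.+1 N); first last.
  - by move=> i lt_li; rewrite big1 // => j _; apply: Gl.
  - by rewrite /N ltnS -addnA leq_addr.
  rewrite mulr_suml; apply: eq_big_nat => i /andP[_]; rewrite ltnS => le_il.
  rewrite (@sum_nat_trunc _ (G i) m.+1 N); first last.
  - by move=> j; apply: Gm.
  - by rewrite /N ltnS -addnA addnCA leq_addr.
  rewrite mulr_suml; apply: eq_big_nat => j /andP[_]; rewrite ltnS => le_jm.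
  rewrite /G; case: ifP => [le_ijn | nle]; first exact: TH.
  by rewrite /Tterm nle mul0r.
rewrite (@sum_nat_trunc _ (fun i => \sum_(0 <= j < N) G i j) n.+1 N); first last.
- by move=> i lt_ni; rewrite big1 // => j _; apply: Gn; rewrite (leq_trans lt_ni) ?leq_addr.
- by rewrite /N ltnS leq_addl.
apply: eq_big_nat => i /andP[_]; rewrite ltnS => le_in.
rewrite (@sum_nat_trunc _ (G i) (n - i).+1 N).
- apply: eq_big_nat => j /andP[_]; rewrite ltnS => le_j.
  by rewrite /G -leq_subRL // le_j.
- by rewrite ltnS (leq_trans (leq_subr _ _)) // leq_addl.
by move=> j lt_j; apply: Gn; rewrite ltnNge -leq_subRL // -ltnNge.
Qed.

Lemma generic_identity :
  phi43 n (q ^ (- n%:Z)) a c (- q ^ (1 + l%:Z + m%:Z - n%:Z) / (a * c))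
    (q ^ (1 + l%:Z - n%:Z) / a) (q ^ (1 + m%:Z - n%:Z) / c) (- (a * c)) q q
  = qpochs [:: q ^ (1 + l%:Z - n%:Z) / a ^+ 2; - q / a] q l
      / qpochs [:: q ^ (1 + l%:Z) / a ^+ 2; - q ^ (1 - n%:Z) / a] q l
    * (qpochs [:: - a; q ^ (- m%:Z) * c ^+ 2] q n
      / qpochs [:: - (a * c); q ^ (- m%:Z) * c] q n)
    * \sum_(0 <= i < l.+1) \sum_(0 <= j < m.+1) Tterm q a c l m n i j.
Proof.
have Ea : (q ^+ l)^-1 * - a = - al by rewrite /a; field; nz.
have Ea2 : (q ^+ l)^-1 * (- a) ^+ 2 = al ^+ 2 * q ^+ l by rewrite /a; field; nz.
have Ec : (q ^+ m)^-1 * c = ga by rewrite /c; field; nz.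
have Ec2 : (q ^+ m)^-1 * c ^+ 2 = ga ^+ 2 * q ^+ m by rewrite /c; field; nz.
rewrite phi43_generic phi_sum_generic sum_xfac //; first last.
- rewrite /expandable Ea Ea2; apply/and3P; split; first exact: generic_mal.
    by apply: generic_al2; rewrite addnC leq_add2r leq_addr.
  case/and5P: gen => _ _ h _ _; rewrite sqrrN; apply: qpoch_le_neq0 h.
  by rewrite ltnS leq_addr.
- rewrite /expandable Ec Ec2; apply/and3P; split; first by case/and5P: gen.
    by apply: generic_ga2; rewrite addnC leq_add2r leq_addr.
  case/and5P: gen => _ _ _ _ /and3P[h _ _]; apply: qpoch_le_neq0 h.
  by rewrite ltnS leq_addr.
rewrite Ec Ea sqrrN -sum_Tterm.
have z1 : q ^ (1 + l%:Z - n%:Z) / a ^+ 2 = q * q ^+ l / (q ^+ n * a ^+ 2) by rewrite exprz_succB //; field; nz.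
have z2 : q ^ (1 - n%:Z) = q / q ^+ n by have := exprz_succB q_neq0 0 n; rewrite addr0 expr0 mulr1.
have z3 : q ^ (1 + l%:Z) = q * q ^+ l by have := exprz_succB q_neq0 l 0; rewrite subr0 expr0 divr1.
rewrite z1 z2 z3 -exprnN !qpochs_cons !qpochs_nil !mulr1 Ec Ec2.
have ql : q ^+ l != 0 := qs l.
have nE : (q ^+ n != 0) := qs n.
have R1 : qp (q * q ^+ l / (q ^+ n * a ^+ 2)) l * qp (al ^+ 2) l * (q * q ^+ l / a ^+ 2) ^+ l
  = qp (q * q ^+ l / a ^+ 2) l * qp (al ^+ 2 * q ^+ n) l * (q * q ^+ l / (q ^+ n * a ^+ 2)) ^+ l.
  by apply: (qpoch_rev2 q_neq0); rewrite /a; field; nz.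
have R2 : qp (- q / a) l * qp (- al * q ^+ n) l * (- (q / q ^+ n) / a) ^+ l
  = qp (- (q / q ^+ n) / a) l * qp (- al) l * (- q / a) ^+ l.
  by apply: (qpoch_rev2 q_neq0); rewrite /a; field; nz.
have R12 : (q * q ^+ l / (q ^+ n * a ^+ 2)) ^+ l * (- q / a) ^+ l
   = (q * q ^+ l / a ^+ 2) ^+ l * (- (q / q ^+ n) / a) ^+ l.
  by rewrite -!exprMn; congr (_ ^+ _); field; nz.
have rv x1 y1 : x1 * y1 * q ^+ l = q -> y1 != 0 -> qp x1 l != 0 -> qp y1 l != 0 /\ y1 ^+ l != 0.
  move=> e y0 xn; split; last exact: expf_neq0.
  by rewrite (qpoch_rev q_neq0 e) !mulf_neq0 // expf_neq0 // oppr_eq0.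
case/and5P: gen => g1 g2 g3 g4 /and3P[g5 g6 g7].
have al2l : qp (al ^+ 2) l != 0.
  by have := @generic_al2 0 l (leq_addl _ _); rewrite expr0 mulr1.
have al2n : qp (al ^+ 2) n != 0.
  by have := @generic_al2 0 n; rewrite expr0 mulr1 add0n -addnA leq_addr => ->.
have D1 : qp (al ^+ 2) n * qp (al ^+ 2 * q ^+ n) l = qp (al ^+ 2) l * qp (al ^+ 2 * q ^+ l) n.
  by rewrite -!qpochD addnC.
have D2 : qp (- al) n * qp (- al * q ^+ n) l = qp (- al) l * qp (- a) n.
  by rewrite /a -mulNr -!qpochD addnC.
move: g2; rewrite qpochD mulf_eq0 negb_or => /andP[mal maln].
have [y2 Y2] : qp (q * q ^+ l / a ^+ 2) l != 0 /\ (q * q ^+ l / a ^+ 2) ^+ l != 0.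
  apply: (rv (al ^+ 2)) => //; first by rewrite /a; field; nz.
  by rewrite !mulf_neq0 // invr_neq0 // mulf_neq0.
have [y4 Y4] : qp (- (q / q ^+ n) / a) l != 0 /\ (- (q / q ^+ n) / a) ^+ l != 0.
  apply: (rv (- al * q ^+ n)) => //; first by rewrite /a; field; nz.
  by rewrite mulf_neq0 ?invr_neq0 // oppr_eq0 mulf_neq0 // invr_neq0.
have an := generic_ma.
(* The prefactor of length [l] becomes one of length [n]: reverse its factorials, then use
   [(x)_n (x q^n)_l = (x)_l (x q^l)_n] for [x = al^2] and [x = - al]. *)
have K : qp (q * q ^+ l / (q ^+ n * a ^+ 2)) l * qp (- q / a) l
    / (qp (q * q ^+ l / a ^+ 2) l * qp (- (q / q ^+ n) / a) l)
  = qp (al ^+ 2 * q ^+ l) n * qp (- al) n / (qp (- a) n * qp (al ^+ 2) n).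
  have -> : qp (al ^+ 2 * q ^+ l) n = qp (al ^+ 2) n * qp (al ^+ 2 * q ^+ n) l / qp (al ^+ 2) l.
    by rewrite D1 [qp (al ^+ 2) l * _]mulrC mulfK.
  have -> : qp (- al) n = qp (- al) l * qp (- a) n / qp (- al * q ^+ n) l by rewrite -D2 mulfK.
  have -> : qp (q * q ^+ l / (q ^+ n * a ^+ 2)) l
    = qp (q * q ^+ l / a ^+ 2) l * qp (al ^+ 2 * q ^+ n) l * (q * q ^+ l / (q ^+ n * a ^+ 2)) ^+ l
      / (qp (al ^+ 2) l * (q * q ^+ l / a ^+ 2) ^+ l).
    by apply: (canRL (mulfK (mulf_neq0 al2l Y2))); rewrite mulrA R1.
  have -> : qp (- q / a) l = qp (- (q / q ^+ n) / a) l * qp (- al) l * (- q / a) ^+ l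
      / (qp (- al * q ^+ n) l * (- (q / q ^+ n) / a) ^+ l).
    by apply: (canRL (mulfK (mulf_neq0 maln Y4))); rewrite mulrA R2.
  have : (- q / a) ^+ l != 0 by rewrite expf_neq0 // mulf_neq0 ?invr_neq0 // oppr_eq0.
  move: R12 y2 Y2 y4 Y4.
  move: ((q * q ^+ l / (q ^+ n * a ^+ 2)) ^+ l : F) ((- q / a) ^+ l : F) ((q * q ^+ l / a ^+ 2) ^+ l : F)
    ((- (q / q ^+ n) / a) ^+ l : F) (qp (q * q ^+ l / a ^+ 2) l) (qp (- (q / q ^+ n) / a) l).
  move=> Z1 Z2 Z3 Z4 Z5 Z6 R12' s5 s3 s6 s4 s2.
  have -> : Z1 = Z3 * Z4 / Z2 by rewrite -R12' mulfK.
  by field; nz.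
rewrite K /efac -qpoch_sqr.
have acn : qp (- (a * c)) n != 0 by [].
move: (\sum_(0 <= i < l.+1) _) => S.
by field; nz.
Qed.
End GenericIdentity.

(** * Rational functions of [t] without a pole at 1 *)

Section Density.
Variable F : numFieldType.
Implicit Types (f g : F -> F) (A : F -> Prop).

(** Agreement with [P / D] is asked only off the zeros of [D], as inverses of 0 are 0 by convention
    and [f] may take spurious values there. The point 1 is never such a zero. *)
Definition regular f := exists P D : {poly F},
  D.[1] != 0 /\ forall t, D.[t] != 0 -> f t = P.[t] / D.[t].

Definition almost_all A := exists2 B : {poly F}, B != 0 & forall t, B.[t] != 0 -> A t.

Lemma regular_const x : regular (fun=> x).
Proof.
exists x%:P, 1; rewrite hornerC oner_neq0; split=> // t _.
by rewrite !hornerC divr1.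
Qed.

Lemma regular_id : regular id.
Proof.
exists 'X, 1; rewrite hornerC oner_neq0; split=> // t _.
by rewrite hornerX hornerC divr1.
Qed.

Lemma regularD f g : regular f -> regular g -> regular (fun t => f t + g t).
Proof.
move=> [P [D [D1 fE]]] [P' [D' [D1' gE]]]; exists (P * D' + P' * D), (D * D').
rewrite hornerM mulf_neq0 //; split=> // t; rewrite hornerM mulf_eq0 negb_or => /andP[Dt Dt'].
by rewrite fE // gE // hornerD !hornerM addf_div.
Qed.

Lemma regularM f g : regular f -> regular g -> regular (fun t => f t * g t).
Proof.
move=> [P [D [D1 fE]]] [P' [D' [D1' gE]]]; exists (P * P'), (D * D').
rewrite hornerM mulf_neq0 //; split=> // t; rewrite hornerM mulf_eq0 negb_or => /andP[Dt Dt'].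
by rewrite fE // gE // !hornerM mulf_div.
Qed.

Lemma regularV f : f 1 != 0 -> regular f -> regular (fun t => (f t)^-1).
Proof.
move=> f1 [P [D [D1 fE]]]; exists (D * D), (P * D).
have P1 : P.[1] != 0 by apply: contraNneq f1 => P1; rewrite fE // P1 mul0r.
rewrite hornerM mulf_neq0 //; split=> // t; rewrite hornerM mulf_eq0 negb_or => /andP[Pt Dt].
by rewrite fE // !hornerM invf_div -mulf_div divff // mulr1.
Qed.

Lemma regularN f : regular f -> regular (fun t => - f t).
Proof.
move=> [P [D [D1 fE]]]; exists (- P), D; split=> // t Dt.
by rewrite fE // hornerN mulNr.
Qed.

Lemma regular_ext f g : f =1 g -> regular f -> regular g.
Proof.
by move=> fg [P [D [D1 fE]]]; exists P, D; split=> // t Dt; rewrite -fg fE.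
Qed.

Lemma regular_sum_nat k n (f : nat -> F -> F) :
  (forall i, (k <= i < n)%N -> regular (f i)) ->
  regular (fun t => \sum_(k <= i < n) f i t).
Proof.
move=> rf; have {}rf i : i \in index_iota k n -> regular (f i).
  by rewrite mem_index_iota; apply: rf.
elim: (index_iota k n) rf => [|i r IHr] rf.
  by apply: regular_ext (regular_const 0) => t; rewrite big_nil.
have rr : regular (fun t => \sum_(i <- r) f i t).
  by apply: IHr => j j_r; apply: rf; rewrite inE j_r orbT.
by apply: regular_ext (regularD (rf i (mem_head _ _)) rr) => t; rewrite big_cons.
Qed.

Lemma regular_exp f k : regular f -> regular (fun t => f t ^+ k).
Proof.
move=> rf; elim: k => [|k IHk]; first exact: regular_const.
by apply: regular_ext (regularM rf IHk) => t; rewrite exprS.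
Qed.

Lemma regular_qpoch f q k : regular f -> regular (fun t => qpoch (f t) q k).
Proof.
move=> rf; elim: k => [|k IHk].
  by apply: regular_ext (regular_const 1) => t; rewrite qpoch0.
have rk := regularD (regular_const 1) (regularN (regularM rf (regular_const (q ^+ k)))).
by apply: regular_ext (regularM IHk rk) => t; rewrite qpochS.
Qed.

Lemma regular_qpochs_nil q k : regular (fun t => qpochs [::] q k).
Proof. exact: regular_const. Qed.

Lemma regular_qpochs_cons f (s : F -> seq F) q k :
  regular f -> regular (fun t => qpochs (s t) q k) ->
  regular (fun t => qpochs (f t :: s t) q k).
Proof.
move=> rf rs; apply: regular_ext (regularM (regular_qpoch q k rf) rs) => t.
by rewrite qpochs_cons.
Qed.

Lemma poly_all_roots_eq0 (P : {poly F}) : (forall t, P.[t] = 0) -> P = 0.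
Proof.
move=> P0; apply/eqP; apply: contraT => Pn0.
have := max_poly_roots Pn0 (rs := [seq k%:R : F | k <- iota 0 (size P)]).
rewrite size_map size_iota ltnn => -> //.
  by apply/allP => x _; rewrite rootE P0.
by rewrite map_inj_uniq ?iota_uniq // => i j /eqP; rewrite eqr_nat => /eqP.
Qed.

(** The cross-multiplied difference times [B D D'] vanishes at every point, hence is the zero
    polynomial. Cancelling the nonzero polynomials [B], [D], [D'] and evaluating at 1 gives the
    claim. *)
Lemma regular_eq f g : regular f -> regular g ->
  almost_all (fun t => f t = g t) -> f 1 = g 1.
Proof.
move=> [P [D [D1 fE]]] [P' [D' [D1' gE]]] [B B0 fg].
have /eqP : (P * D' - P' * D) * (B * (D * D')) = 0.
  apply: poly_all_roots_eq0 => t; rewrite !hornerM hornerD hornerN !hornerM.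
  have [->|Bt] := eqVneq B.[t] 0; first by rewrite mul0r mulr0.
  have [->|Dt] := eqVneq D.[t] 0; first by rewrite mul0r !mulr0.
  have [->|Dt'] := eqVneq D'.[t] 0; first by rewrite !mulr0.
  by have /eqP := fg t Bt; rewrite fE // gE // eqr_div // => /eqP->; rewrite subrr mul0r.
have Dn0 : D != 0 by apply: contraNneq D1 => ->; rewrite horner0.
have Dn0' : D' != 0 by apply: contraNneq D1' => ->; rewrite horner0.
rewrite !mulf_eq0 (negPf B0) (negPf Dn0) (negPf Dn0') !orbF subr_eq0 => /eqP e.
apply/eqP; rewrite fE // gE // eqr_div //.
by have /(congr1 (fun p => p.[1])) := e; rewrite !hornerM => ->.
Qed.

Lemma almost_and A1 A2 : almost_all A1 -> almost_all A2 -> almost_all (fun t => A1 t /\ A2 t).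
Proof.
move=> [B B0 h] [B' B0' h']; exists (B * B'); first exact: mulf_neq0.
by move=> t; rewrite hornerM mulf_eq0 negb_or => /andP[/h h1 /h' h2].
Qed.

Lemma almost_imply A1 A2 : (forall t, A1 t -> A2 t) -> almost_all A1 -> almost_all A2.
Proof. by move=> h [B B0 hB]; exists B => // t /hB/h. Qed.

Lemma almost_neq0 : almost_all (fun t => t != 0).
Proof. by exists 'X; [rewrite polyX_eq0 | move=> t; rewrite hornerX]. Qed.

Lemma almost_qpoch x e q k : almost_all (fun t => qpoch (x * t ^+ e.+1) q k != 0).
Proof.
elim: k => [|k [B B0 hB]].
  by exists 1; [exact: oner_neq0 | move=> t _; rewrite qpoch0 oner_neq0].
exists (B * (1 - (x * q ^+ k) *: 'X ^+ e.+1)).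
  (* The exponent [e + 1] is positive, so the new factor takes the value 1 at [t = 0] and is a
     nonzero polynomial. *)
  rewrite mulf_neq0 //; apply/eqP => /(congr1 (fun p => p.[0])).
  by rewrite !hornerE /= expr0n mulr0 subr0 => /eqP; rewrite oner_eq0.
move=> t; rewrite hornerM mulf_eq0 negb_or => /andP[/hB h1].
by rewrite !hornerE qpochS mulf_eq0 negb_or h1 mulrAC.
Qed.

End Density.

Ltac regular_tac := repeat first
  [ apply: regular_const | apply: regular_id | apply: regularD | apply: regularN
  | apply: regular_qpochs_nil | apply: regular_qpochs_cons | apply: regular_exp
  | apply: regularV | apply: regularM ].

(** * Scaling the parameters by [t] and return to [t = 1] *)

Section Final.
Variable F : numFieldType.
Variables (q a c : F) (l m n : nat).
Hypotheses (q_neq0 : q != 0) (a_neq0 : a != 0) (c_neq0 : c != 0).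

Let qs (z : int) : q ^ z != 0. Proof. exact: expfz_neq0. Qed.

Lemma regular_phi43 :
  (forall k : nat, (k <= n)%N ->
     qpochs [:: q; q ^ (1 + l%:Z - n%:Z) / a; q ^ (1 + m%:Z - n%:Z) / c;
                - (a * c)] q k != 0) ->
  regular (fun t => phi43 n (q ^ (- n%:Z)) (a * t) (c * t ^+ 2)
    (- q ^ (1 + l%:Z + m%:Z - n%:Z) / (a * t * (c * t ^+ 2)))
    (q ^ (1 + l%:Z - n%:Z) / (a * t)) (q ^ (1 + m%:Z - n%:Z) / (c * t ^+ 2))
    (- (a * t * (c * t ^+ 2))) q q).
Proof.
move=> den; apply: regular_sum_nat => k /andP[_]; rewrite ltnS => /den h.
(* The goals left by [regular_tac] are the conditions of [regularV]: the denominators at [t = 1],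
   that is, at the original parameters. *)
regular_tac; rewrite ?mulr1 ?expr1n ?mulr1 ?mulf_neq0 //.
Qed.

Lemma regular_Tterm i j :
  1 - q ^ (- 2 * l%:Z - 1) * a ^+ 2 != 0 ->
  ((i + j <= n)%N -> ~~ odd (n - i - j) ->
     [/\ qpochs [:: q; q ^ (n%:Z - 2 * l%:Z) * a ^+ 2;
                    q ^ (- l%:Z) * a ^+ 2] q i != 0,
         qpochs [:: q; q ^ (1 + l%:Z - n%:Z) / a; - q ^ (1 + l%:Z - n%:Z) / a;
                    q ^ (- m%:Z) * c ^+ 2;
                    q ^ (j%:Z - 2 * m%:Z - 1) * c ^+ 2] q j != 0
       & qpochs [:: q ^ (2 + 2 * l%:Z - 2 * n%:Z + 2 * j%:Z) / a ^+ 2;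
                    q ^ (1 - 2 * m%:Z + 2 * j%:Z) * c ^+ 2]
                (q ^+ 2) (n - i - j)./2 != 0]) ->
  regular (fun t => Tterm q (a * t) (c * t ^+ 2) l m n i j).
Proof.
move=> den0 den; rewrite /Tterm.
have [le_ijn | _] := boolP (i + j <= n)%N; last exact: regular_const.
have [odd_N | even_N] := boolP (odd (n - i - j)).
  apply: regular_ext (regular_const 0) => t.
  by rewrite /chi -[(-1) ^+ (n - i - j)]signr_odd odd_N expr1 subrr mul0r mulr0.
have [d1 d2 d3] := den le_ijn even_N.
regular_tac; rewrite ?mulr1 ?expr1n ?mulr1 ?mulf_neq0 ?expf_neq0 //.
Qed.

Lemma scaled_identity_almost :
  (2%:R : F) != 0 -> qpoch q q n != 0 ->
  almost_all (fun t =>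
    phi43 n (q ^ (- n%:Z)) (a * t) (c * t ^+ 2)
      (- q ^ (1 + l%:Z + m%:Z - n%:Z) / (a * t * (c * t ^+ 2)))
      (q ^ (1 + l%:Z - n%:Z) / (a * t)) (q ^ (1 + m%:Z - n%:Z) / (c * t ^+ 2))
      (- (a * t * (c * t ^+ 2))) q q
    = qpochs [:: q ^ (1 + l%:Z - n%:Z) / (a * t) ^+ 2; - q / (a * t)] q l
        / qpochs [:: q ^ (1 + l%:Z) / (a * t) ^+ 2; - q ^ (1 - n%:Z) / (a * t)] q l
      * (qpochs [:: - (a * t); q ^ (- m%:Z) * (c * t ^+ 2) ^+ 2] q n
        / qpochs [:: - (a * t * (c * t ^+ 2)); q ^ (- m%:Z) * (c * t ^+ 2)] q n)
      * \sum_(0 <= i < l.+1) \sum_(0 <= j < m.+1) Tterm q (a * t) (c * t ^+ 2) l m n i j).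
Proof.
move=> two qn; pose al := a / q ^+ l; pose ga := c / q ^+ m.
have ql := expf_neq0 l q_neq0; have qm := expf_neq0 m q_neq0.
have al0 : al != 0 by rewrite mulf_neq0 ?invr_neq0.
have ga0 : ga != 0 by rewrite mulf_neq0 ?invr_neq0.
have aE t : al * t * q ^+ l = a * t by rewrite /al mulrAC mulfVK.
have cE t : ga * t ^+ 2 * q ^+ m = c * t ^+ 2 by rewrite /ga mulrAC mulfVK.
clearbody al ga.
(* The second argument of [almost_qpoch] is one less than the exponent of [t]; the exponents are 1,
   1, 2, 2, 4, 6, 3 in the order of [generic_params]. *)
have H := almost_and (almost_neq0 F) (almost_and (almost_qpoch al 0 q n)
  (almost_and (almost_qpoch (- al) 0 q (n + l))
  (almost_and (almost_qpoch (al ^+ 2 / q) 1 q (n + n + l).+1)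
  (almost_and (almost_qpoch ga 1 q n)
  (almost_and (almost_qpoch (ga ^+ 2 / q) 3 q (n + n + m).+1)
  (almost_and (almost_qpoch (ga ^+ 2 * al ^+ 2) 5 q (n + n))
     (almost_qpoch (- (a * c)) 2 q n))))))).
apply: almost_imply H => t [t0 [h1 [h2 [h3 [h4 [h5 [h6 h7]]]]]]].
have := @generic_identity _ _ q_neq0 (al * t) (ga * t ^+ 2) l m n.
rewrite aE cE; apply; rewrite ?mulf_neq0 ?expf_neq0 //.
rewrite /generic_params; cbv zeta; rewrite aE cE; apply/and5P; split.
- exact: h1.
- by rewrite (_ : - (al * t) = - al * t ^+ 1) //; ring.
- by rewrite (_ : (al * t) ^+ 2 / q = al ^+ 2 / q * t ^+ 2) //; ring.
- exact: h4.
apply/and3P; split.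
- by rewrite (_ : (ga * t ^+ 2) ^+ 2 / q = ga ^+ 2 / q * t ^+ 4) //; ring.
- by rewrite (_ : (ga * t ^+ 2) ^+ 2 * (al * t) ^+ 2 = ga ^+ 2 * al ^+ 2 * t ^+ 6) //; ring.
by rewrite (_ : - (a * t * (c * t ^+ 2)) = - (a * c) * t ^+ 3) //; ring.
Qed.
End Final.

Theorem mainTheorem4 (R : realType) (q a c : R[i]) (l m n : nat)
  (q_neq0 : q != 0) (a_neq0 : a != 0) (c_neq0 : c != 0)
  (* denominators of the 4phi3 series *)
  (phi_den : forall k : nat, (k <= n)%N ->
     qpochs [:: q; q ^ (1 + l%:Z - n%:Z) / a; q ^ (1 + m%:Z - n%:Z) / c;
                - (a * c)] q k != 0)
  (* denominators of the prefactor *)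
  (pre_den_l :
     qpochs [:: q ^ (1 + l%:Z) / a ^+ 2; - q ^ (1 - n%:Z) / a] q l != 0)
  (pre_den_n : qpochs [:: - (a * c); q ^ (- m%:Z) * c] q n != 0)
  (* denominators of the terms T_(i,j) that are not read as 0 *)
  (T_den0 : 1 - q ^ (- 2 * l%:Z - 1) * a ^+ 2 != 0)
  (T_den : forall i j : nat, (i <= l)%N -> (j <= m)%N -> (i + j <= n)%N ->
     ~~ odd (n - i - j) ->
     [/\ qpochs [:: q; q ^ (n%:Z - 2 * l%:Z) * a ^+ 2;
                    q ^ (- l%:Z) * a ^+ 2] q i != 0,
         qpochs [:: q; q ^ (1 + l%:Z - n%:Z) / a; - q ^ (1 + l%:Z - n%:Z) / a;
                    q ^ (- m%:Z) * c ^+ 2;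
                    q ^ (j%:Z - 2 * m%:Z - 1) * c ^+ 2] q j != 0
       & qpochs [:: q ^ (2 + 2 * l%:Z - 2 * n%:Z + 2 * j%:Z) / a ^+ 2;
                    q ^ (1 - 2 * m%:Z + 2 * j%:Z) * c ^+ 2]
                (q ^+ 2) (n - i - j)./2 != 0]) :
  phi43 n (q ^ (- n%:Z)) a c (- q ^ (1 + l%:Z + m%:Z - n%:Z) / (a * c))
    (q ^ (1 + l%:Z - n%:Z) / a) (q ^ (1 + m%:Z - n%:Z) / c) (- (a * c)) q q
  = qpochs [:: q ^ (1 + l%:Z - n%:Z) / a ^+ 2; - q / a] q l
      / qpochs [:: q ^ (1 + l%:Z) / a ^+ 2; - q ^ (1 - n%:Z) / a] q l
    * (qpochs [:: - a; q ^ (- m%:Z) * c ^+ 2] q n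
      / qpochs [:: - (a * c); q ^ (- m%:Z) * c] q n)
    * \sum_(0 <= i < l.+1) \sum_(0 <= j < m.+1) Tterm q a c l m n i j.
Proof.
have qn : qpoch q q n != 0.
  by have := phi_den n (leqnn n); rewrite qpochs_cons mulf_eq0 => /norP[].
have two : (2%:R : R[i]) != 0 by rewrite pnatr_eq0.
(* Both sides agree for almost all [t], hence at [t = 1], where the scaled parameters are [a] and
   [c]. It remains to show that the right side is regular. *)
have := regular_eq (regular_phi43 a_neq0 c_neq0 phi_den) _
  (scaled_identity_almost l m q_neq0 a_neq0 c_neq0 two qn).
rewrite expr1n !mulr1; apply.
apply: regularM; last first.
  apply: regular_sum_nat => i /andP[_ le_il]; apply: regular_sum_nat => j /andP[_ le_jm].
  by apply: regular_Tterm => // le_ijn ev; apply: T_den.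
regular_tac; rewrite ?mulr1 ?expr1n ?mulr1 ?mulf_neq0 ?expf_neq0 //.
Qed.
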